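(* Let $\kappa \leq \lambda = \lambda^{<\kappa}$ be cardinals, with $\kappa$ regular and uncountable. The following are equivalent. (1) For every transitive model $M$ of size $\lambda$ with ${}^{<\kappa}M\subseteq M$, there is a transitive model $N$ and an elementary embedding $j\colon M \to N$ such that $\operatorname{crit} j = \kappa$, $\lambda < j(\kappa)$ and $j''M \in N$. (2) $\kappa$-$\mathcal{L}_{\kappa,\kappa}$-compactness with type omission for languages of size $\lambda$ holds. (3) $\kappa$-$\mathcal{L}_{\omega,\omega}$-compactness with type omission for languages of size $\lambda$ holds.
   Context: For a map $j$ and a set $M$, $j''M=\{j(x)\mid x\in M\}$. $\operatorname{crit} j$ is the critical point of $j$. ${}^{<\kappa}M$ is the set of all sequences of length $<\kappa$ of elements of $M$. Models $M,N$ in (1) are $\in$-structures. For a regular cardinal $\kappa$ and a set $X$, $P_\kappa X=\{x\subseteq X\mid |x|<\kappa\}$. A set $C\subseteq P_\kappa X$ is a club if for every $x\in P_\kappa X$ there is $y\in C$ with $x\subseteq y$, and for every increasing (with respect to $\subseteq$) sequence $\langle x_i\mid i<i_\star\rangle$ of elements of $C$ with $i_\star<\kappa$, $\bigcup_i x_i\in C$. ''For club many $x$'' means for all $x$ in some club. $\mathcal{L}_{\omega,\omega}$ is first order logic; $\mathcal{L}_{\kappa,\kappa}$ is the infinitary logic allowing conjunctions and disjunctions of fewer than $\kappa$ formulas and quantification over fewer than $\kappa$ variables. Let $\mathcal{L}$ be a logic extending first order logic. An $\mathcal L$-theory is a set of $\mathcal L$-sentences, and an $\mathcal L$-type $p=p(x)$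 is a set of $\mathcal L$-formulas in the free variable $x$; a model omits $p$ if no element of it satisfies all formulas of $p$. Elements of $P_\kappa(T\cup p)$ are written as $T'\cup p'$ with $T'\subseteq T$ and $p'\subseteq p$. We say that $\kappa$-$\mathcal{L}$-compactness with type omission for languages of size $\lambda$ holds if for every $\mathcal{L}$-theory $T$ and $\mathcal{L}$-type $p$ (over a language of size $\lambda$) such that for club many $T' \cup p'\in P_\kappa (T \cup p)$ there is a model of $T'$ that omits $p'$, there is a model of $T$ that omits $p$.
   Formalization: In (1), M is any transitive set that also contains κ and the set of values of each <κ-sequence (for bare transitive sets (1) would otherwise always fail); club closure is required only for nonempty increasing sequences, as otherwise (2) and (3) are vacuous. *)

(* Defs.v *)
From mathcomp Require Import all_boot.
From mathcomp Require Export boolp classical_sets functions cardinality.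

Set Implicit Arguments.
Unset Strict Implicit.
Unset Printing Implicit Defensive.

Local Open Scope classical_set_scope.
Local Open Scope card_scope.

(** The universe of sets: well-founded trees (Aczel) up to extensional
    equality.  With the classical axioms of [boolp] it satisfies ZFC, and every
    class that is in bijection with a set is a set, so that functions between
    sets can be taken to be functions of the metatheory. *)

Inductive tree : Type := sup (A : Type) (f : A -> tree).

Fixpoint tree_eq (x y : tree) : Prop :=
  let: sup A f := x in let: sup B g := y in
  (forall i, exists j, tree_eq (f i) (g j)) /\
  (forall j, exists i, tree_eq (f i) (g j)).

Definition V := {C : set tree | exists x, C = [set y | tree_eq x y]}.

Definition elem (x y : V) : Prop :=
  exists (A : Type) (f : A -> tree) (i : A), sval y (sup f) /\ sval x (f i).

Notation "x ∈ y" := (elem x y) (at level 70, no associativity).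

Definition elts (x : V) : set V := [set y | y ∈ x].
Coercion elts : V >-> set.

Definition transitive_set (x : V) := forall y, y ∈ x -> y `<=` x.

Definition is_ordinal (a : V) :=
  transitive_set a /\ forall b, b ∈ a -> transitive_set b.

Definition card_lt T U (A : set T) (B : set U) := A #<= B /\ ~ (B #<= A).

Definition is_cardinal (k : V) :=
  is_ordinal k /\ forall a, a ∈ k -> card_lt a k.

Definition regular (k : V) :=
  [/\ is_cardinal k, infinite_set k &
      forall X : set V, X `<=` k -> card_lt X k ->
        exists2 b, b ∈ k & forall a, X a -> a ∈ b].

(** [lt_seq k X] is the type of sequences of length less than [k] of elements
    of [X], for [k] an ordinal. *)
Definition lt_seq (k X : V) := {a : k & elts (val a) -> X}.

Definition is_upair (z a b : V) := z = [set a; b] :> set V.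

Definition is_pair (p a b : V) :=
  exists u v, [/\ is_upair u a a, is_upair v a b & is_upair p u v].

Definition is_graph k X (s : lt_seq k X) (g : V) :=
  forall p, p ∈ g <-> exists i, is_pair p (val i) (val (projT2 s i)).

(** Closure of [M] under sequences of length less than [k].  Besides the
    sequence itself (a set of Kuratowski pairs), the set of its values has to
    belong to [M].  In a model of set theory the former implies the latter, but
    in a bare transitive set it does not, and [embedding_property] below would
    then fail, for instance, whenever [lambda] is [kappa]: in the least
    transitive set that contains [kappa] and the sets of hereditary size less
    than [kappa] and is closed under sequences as sets of pairs, every set that
    has [kappa] as an element has at most two elements, so the image of [j]
    cannot belong to [N]. *)
Definition seq_closed (k M : V) :=
  forall s : lt_seq k M,
    (exists2 g, g ∈ M & is_graph s g) /\
    (exists2 r, r ∈ M & r = range (val \o projT2 s) :> set V).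

Definition Pk T (k : V) (X : set T) : set (set T) :=
  [set y | y `<=` X /\ card_lt y k].

(** Only nonempty increasing sequences are considered: the empty one would put
    the empty set in every club. *)
Definition club T (k : V) (X : set T) (C : set (set T)) :=
  [/\ C `<=` Pk k X,
      forall x, Pk k X x -> exists2 y, C y & x `<=` y &
      forall (a : V) (x : a -> set T), a ∈ k -> a !=set0 ->
        (forall i, C (x i)) ->
        (forall i j, val i ∈ val j -> x i `<=` x j) ->
        C (\bigcup_i x i)].

Record language := Language {
  fun_sym : Type;
  fun_ar : fun_sym -> nat;
  rel_sym : Type;
  rel_ar : rel_sym -> nat }.

(** The logics L_{mu,mu} differ by their variables and by the lengths of their
    conjunctions and quantifier blocks; a length [n] is given with the type
    [idx n] of the positions below it. *)
Record logic := Logic {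
  var : Type;
  len : Type;
  idx : len -> Type }.

Definition Lww : logic := @Logic nat nat ordinal.

Definition Lkk (k : V) : logic := @Logic k k (fun a => elts (val a)).

Inductive term (L : language) (l : logic) : Type :=
| Var of var l
| App (f : fun_sym L) of 'I_(fun_ar f) -> term L l.

(** Disjunctions and universal quantifiers are the De Morgan duals of the
    conjunctions and existential quantifiers below.  [Ex n xs phi] binds all
    the variables [xs i] at once. *)
Inductive formula (L : language) (l : logic) : Type :=
| Eq of term L l & term L l
| Rel (r : rel_sym L) of 'I_(rel_ar r) -> term L l
| Neg of formula L l
| And (n : len l) of idx n -> formula L l
| Ex (n : len l) of idx n -> var l & formula L l.

Fixpoint term_vars L l (t : term L l) : set (var l) :=
  match t with
  | Var x => [set x]
  | App _ ts => \bigcup_i term_vars (ts i)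
  end.

Fixpoint free_vars L l (phi : formula L l) : set (var l) :=
  match phi with
  | Eq t u => term_vars t `|` term_vars u
  | Rel _ ts => \bigcup_i term_vars (ts i)
  | Neg phi => free_vars phi
  | And _ phis => \bigcup_i free_vars (phis i)
  | Ex _ xs phi => free_vars phi `\` range xs
  end.

Record structure (L : language) := Structure {
  dom : V;
  fun_int : forall f : fun_sym L, ('I_(fun_ar f) -> dom) -> dom;
  rel_int : forall r : rel_sym L, ('I_(rel_ar r) -> dom) -> Prop }.

Fixpoint eval L l (A : structure L) (s : var l -> dom A) (t : term L l)
    : dom A :=
  match t with
  | Var x => s x
  | App f ts => @fun_int _ A f (fun i => eval s (ts i))
  end.

Fixpoint sat L l (A : structure L) (s : var l -> dom A) (phi : formula L l)
    : Prop :=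
  match phi with
  | Eq t u => eval s t = eval s u
  | Rel r ts => @rel_int _ A r (fun i => eval s (ts i))
  | Neg phi => ~ sat s phi
  | And _ phis => forall i, sat s (phis i)
  | Ex _ xs phi =>
      exists2 s' : var l -> dom A,
        (forall v, ~ range xs v -> s' v = s v) & sat s' phi
  end.

Definition is_theory L l (T : set (formula L l)) :=
  forall phi, T phi -> free_vars phi = set0.

Definition is_type L l (x : var l) (p : set (formula L l)) :=
  forall phi, p phi -> free_vars phi `<=` [set x].

Definition models L l (A : structure L) (T : set (formula L l)) :=
  dom A !=set0 /\ forall phi, T phi -> forall s : var l -> dom A, sat s phi.

(** As the formulas of a type have a single free variable, an element [a] is
    evaluated under the constant assignment to [a]. *)
Definition omits L l (A : structure L) (p : set (formula L l)) :=
  forall a : dom A, ~ (forall phi, p phi -> sat (fun=> a) phi).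

Definition has_size (L : language) (lambda : V) :=
  [set: fun_sym L + rel_sym L] #= lambda.

(** An element [y] of [Pk kappa (T `|` p)] is decomposed as the union of
    [y `&` T] and [y `&` p]. *)
Definition compact_type_omission (kappa : V) (l : logic) (lambda : V) :=
  forall (L : language) (T : set (formula L l)) (x : var l)
         (p : set (formula L l)),
    has_size L lambda -> is_theory T -> is_type x p ->
    (exists2 C, club kappa (T `|` p) C &
       forall y, C y ->
         exists2 A : structure L, models A (y `&` T) & omits A (y `&` p)) ->
    exists2 A : structure L, models A T & omits A p.

Definition Lin : language :=
  @Language void (fun=> 0) unit (fun=> 2).

Definition in_structure (M : V) : structure Lin :=
  @Structure Lin M
    (fun f => match f with end)
    (fun r (a : 'I_2 -> M) => val (a ord0) ∈ val (a ord_max)).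

Definition elementary (M N : V) (j : M -> N) :=
  forall (phi : formula Lin Lww) (s : nat -> M),
    @sat _ Lww (in_structure M) s phi <->
    @sat _ Lww (in_structure N) (j \o s) phi.

Definition is_crit (M N : V) (j : M -> N) (k : M) :=
  [/\ is_ordinal (val k), val (j k) <> val k &
      forall a : M, val a ∈ val k -> val (j a) = val a].

(** The ordinal [kappa] is required to belong to [M], as it has to be in the
    domain of an embedding with critical point [kappa]. *)
Definition embedding_property (kappa lambda : V) :=
  forall M : V, transitive_set M -> M #= lambda -> kappa ∈ M ->
    seq_closed kappa M ->
    exists (N : V) (j : M -> N),
      [/\ transitive_set N,
          elementary j,
          exists k : M, [/\ val k = kappa, is_crit j k & lambda ∈ val (j k)] &
          exists2 y, y ∈ N & y = range (val \o j) :> set V].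

(* Main.v *)
Require Import Defs.
From mathcomp Require Import all_boot.
From mathcomp Require Import boolp classical_sets functions cardinality.

(** All three properties say that [P_kappa lambda] carries a fragment of a normal
    measure: for every family of at most [lambda] functions from index sets
    [x] in [P_kappa lambda] to [lambda] there is a [kappa]-complete fine filter for
    which the regressive functions of the family are constant on a set of the
    filter ([normal_filters]).  Such a filter can in addition decide [lambda] many
    prescribed sets and be closed under [lambda] many prescribed diagonal
    intersections ([normal_filters_diag]).

    From filters to models: given structures [A x] indexed by [P_kappa lambda] in a
    language of size [lambda], the assumption [lambda^<kappa = lambda] allows one to
    close any [lambda] many elements of the product under Skolem functions of the
    infinitary logic without exceeding size [lambda]; with a filter that decides the
    [lambda] many sets of the form { x | A x satisfies phi }, the quotient of this
    part of the product satisfies the theorem of Los ([los]).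
    - For type omission ([normal_compact]), [A x] is a model of the part of the
      theory that is coded in [x] and omits the part of the type coded in [x].
      Normality turns the choice of a formula that an element fails to satisfy
      into a single formula of the type, so the type is omitted.  The filter
      contains the given club because almost every [x] codes a directed part of
      it, and a club is closed under small directed unions ([normal_club],
      [club_directed]).
    - For embeddings ([normal_embedding]), all [A x] are the given transitive set
      [M].  The quotient is well founded by countable completeness, and the
      function that sends [x] to the subset of [M] coded by [x] represents the
      image of the embedding, by normality.

    From models to filters, an intermediate notion is used: [coherent_values] asks
    for a relation [E i a], to be read as f_i(d) = a for an ideal element [d] of
    [P_kappa lambda], subject to a few finitary conditions.  The family [f] is first
    closed under the operation that tests fewer than [kappa] many equations
    f_i(x) = a at once; the sets defined by the equations that hold at [d] then
    generate a [kappa]-complete normal filter ([coherent_normal]).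
    - From type omission, already in first order logic ([compact_coherent]): [d] is
      a unary predicate, the theory consists of the sentences that hold for all
      large [x], and omitting the type { d(v) } together with all v <> c_a makes
      [d] consist of the named elements only.
    - From embeddings ([embedding_coherent]): [d] is j''lambda, computed in a
      transitive set [M] that is tailored to the family [f].  The only delicate
      point is that [d] has size less than j(kappa) in the target: otherwise the
      target would contain an increasing function from j(kappa) to j''lambda, which
      has order type [lambda], although [lambda] is less than j(kappa). *)

Set Implicit Arguments.
Unset Strict Implicit.
Unset Printing Implicit Defensive.

Local Open Scope classical_set_scope.
Local Open Scope card_scope.

(** * Sets and ordinals *)

Definition the T (t0 : T) (P : set T) : T := @xget {classic T} t0 P.

Lemma theP T (t0 : T) (P : set T) : P !=set0 -> P (the t0 P).
Proof. exact: (@xgetPex {classic T}). Qed.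

Lemma tree_eq_refl x : tree_eq x x.
Proof. by elim: x => A f IH /=; split=> i; exists i. Qed.

Lemma tree_eq_sym x y : tree_eq x y -> tree_eq y x.
Proof.
elim: x y => A f IH [B g] /= [h1 h2]; split=> i.
  by have [j /IH] := h2 i; exists j.
by have [j /IH] := h1 i; exists j.
Qed.

Lemma tree_eq_trans y x z : tree_eq x y -> tree_eq y z -> tree_eq x z.
Proof.
elim: y x z => B g IH [A f] [C h] /= [h1 h2] [h3 h4]; split=> i.
  by have [j fg] := h1 i; have [k gh] := h3 j; exists k; apply: IH gh.
by have [j gh] := h4 i; have [k fg] := h2 j; exists k; apply: IH gh.
Qed.

Definition cls (t : tree) : V :=
  exist _ [set y | tree_eq t y] (ex_intro _ t erefl).

Lemma V_cls (x : V) : exists t, x = cls t.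
Proof.
case: x => C [t Ct]; exists t; subst C.
by congr exist; apply: Prop_irrelevance.
Qed.

Lemma cls_eq t u : (cls t = cls u) <-> tree_eq t u.
Proof.
split=> [tu|tu]; first by have /= := f_equal (fun x => sval x u) tu => ->;
  apply: tree_eq_refl.
suff e : [set y | tree_eq t y] = [set y | tree_eq u y] by exact: eq_exist.
apply/seteqP; split=> y /=; last exact: tree_eq_trans.
by apply: tree_eq_trans; apply: tree_eq_sym.
Qed.

Lemma elem_cls x A (f : A -> tree) : x ∈ cls (sup f) <-> exists i, x = cls (f i).
Proof.
have [t ->] := V_cls x; split.
  move=> [B [g [i [/= [h1 h2] tg]]]].
  have [j fg] := h2 i; exists j; apply/cls_eq.
  by apply: tree_eq_trans tg _; apply: tree_eq_sym.
move=> [i /cls_eq tf]; exists A, f, i; split=> //; exact: tree_eq_refl.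
Qed.

Lemma V_ext (x y : V) : (forall z, z ∈ x <-> z ∈ y) -> x = y.
Proof.
have [[A f] ->] := V_cls x; have [[B g] ->] := V_cls y => h.
apply/cls_eq => /=; split=> i.
  have /h/elem_cls[j /cls_eq] : cls (f i) ∈ cls (sup f) by apply/elem_cls; exists i.
  by exists j.
have /h/elem_cls[j /cls_eq] : cls (g i) ∈ cls (sup g) by apply/elem_cls; exists i.
by exists j; apply: tree_eq_sym.
Qed.

Lemma elem_wf : well_founded elem.
Proof.
move=> x; have [t ->] := V_cls x; elim: t => A f IH; constructor=> y.
by move=> /elem_cls[i ->].
Qed.

Lemma elts_inj (x y : V) : x = y :> set V -> x = y.
Proof. by move=> e; apply: V_ext => z; rewrite -[z ∈ x]/(elts x z) e. Qed.

Definition to_elts (a y : V) (h : y ∈ a) : a := exist _ y (mem_set h).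

Lemma eltsP (a : V) (i : a) : val i ∈ a. Proof. exact: set_mem (valP i). Qed.

Definition is_small_class (X : set V) :=
  exists (a : V) (G : a -> V), X `<=` range G.

(** Replacement and separation at once: if the tree [sup f] represents [a], the
    indices of [f] that [G] sends into [X] index a tree representing [X]. *)
Lemma set_of_class (X : set V) : is_small_class X -> exists b : V, X = b.
Proof.
move=> [a [G XG]]; have [[A f] e] := V_cls a; subst a.
have fa i : cls (f i) ∈ cls (sup f) by apply/elem_cls; exists i.
pose g (i : {i : A | X (G (to_elts (fa i)))}) :=
  projT1 (cid (V_cls (G (to_elts (fa (projT1 i)))))).
exists (cls (sup g)); apply/seteqP; split=> x; rewrite /elts /=.
  move=> Xx; apply/elem_cls; have [u _ ux] := XG _ Xx.
  have /elem_cls[i ui] := eltsP u.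
  have e : u = to_elts (fa i) by apply: val_inj; rewrite ui.
  have h : X (G (to_elts (fa i))) by rewrite -e ux.
  exists (exist _ i h); rewrite /g /=.
  by case: cid => t /= <-; rewrite -ux e.
move=> /elem_cls[[i h] ->]; rewrite /g /=.
by case: cid => t /= <-.
Qed.

Definition V0 : V := cls (sup (fun f : void => match f with end)).

Definition mkV (X : set V) : V := the V0 [set b : V | X = b].

Lemma mkVE X : is_small_class X -> mkV X = X :> set V.
Proof. by move=> /set_of_class h; rewrite -(theP V0 h). Qed.

Lemma in_mkV X x : is_small_class X -> (x ∈ mkV X <-> X x).
Proof. by move=> /mkVE e; rewrite -[x ∈ _]/(elts _ x) e. Qed.

Lemma elem_irrefl x : ~ x ∈ x.
Proof. by elim/(well_founded_ind elem_wf): x => x IH xx; apply: (IH x). Qed.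

Lemma elem_asym x y : x ∈ y -> ~ y ∈ x.
Proof.
elim/(well_founded_ind elem_wf): x y => x IH y xy yx.
exact: (IH y yx x yx xy).
Qed.

Lemma wf_no_descent T (R : T -> T -> Prop) (f : nat -> T) :
  well_founded R -> ~ (forall n, R (f n.+1) (f n)).
Proof.
move=> wf h; suff H x : forall n, f n <> x by exact: (H (f 0) 0).
elim/(well_founded_ind wf): x => x IH n e; subst x.
exact: (IH _ (h n) n.+1).
Qed.

Lemma no_descent_wf T (R : T -> T -> Prop) :
  (forall f : nat -> T, ~ (forall n, R (f n.+1) (f n))) -> well_founded R.
Proof.
move=> h x; apply: contrapT => nx.
have step (y : {y | ~ Acc R y}) : exists z : {y | ~ Acc R y}, R (sval z) (sval y).
  case: y => y ny /=; apply: contrapT => H; apply: ny; constructor=> z zy.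
  by apply: contrapT => nz; apply: H; exists (exist _ z nz).
have [g gP] := choice step.
apply: (h (fun n => sval (iter n g (exist _ x nx)))) => n.
exact: gP.
Qed.

Lemma wf_min T (R : T -> T -> Prop) (P : set T) :
  well_founded R -> P !=set0 -> exists2 x, P x & forall y, R y x -> ~ P y.
Proof.
move=> wf [x Px]; apply: contrapT => H; suff : ~ P x by [].
elim/(well_founded_ind wf): x {Px} => x IH Px.
by apply: H; exists x.
Qed.

Lemma ord_elem a b : is_ordinal a -> b ∈ a -> is_ordinal b.
Proof.
move=> [ta ha] ba; split; first exact: ha.
by move=> c cb; apply: ha; apply: (ta b).
Qed.

Lemma ord_trans a b c : is_ordinal a -> b ∈ a -> c ∈ b -> c ∈ a.
Proof. by move=> [ta _] ba cb; apply: (ta b). Qed.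



(** By induction on both ordinals: if some [c] in [a] is not in [b], the comparison
    of [c] with [b] puts [b] into [a], and symmetrically. *)
Lemma ord_trichotomy a b : is_ordinal a -> is_ordinal b ->
  [\/ a ∈ b, a = b | b ∈ a].
Proof.
elim/(well_founded_ind elem_wf): a b => a IHa b.
elim/(well_founded_ind elem_wf): b => b IHb oa ob.
have [ab|nab] := pselect (a `<=` b); last first.
  have [c ca ncb] : exists2 c, c ∈ a & ~ c ∈ b.
    apply: contrapT => H; apply: nab => c ca; apply: contrapT => nc.
    by apply: H; exists c.
  have [] := IHa c ca b (ord_elem oa ca) ob => // [<-|bc].
    exact: Or33.
  by apply: Or33; apply: ord_trans bc.
have [ba|nba] := pselect (b `<=` a).
  by apply: Or32; apply: V_ext => z; split; [apply: ab|apply: ba].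
have [c cb nca] : exists2 c, c ∈ b & ~ c ∈ a.
  apply: contrapT => H; apply: nba => c cb; apply: contrapT => nc.
  by apply: H; exists c.
have [ac|ac|//] := IHb c cb oa (ord_elem ob cb).
  by apply: Or31; apply: ord_trans ac.
by apply: Or31; rewrite ac.
Qed.

(** * Small sets and types of size at most lambda *)

Lemma existT_inj T (P : T -> Type) x (p q : P x) :
  existT P x p = existT P x q -> p = q.
Proof.
move=> h; have := projT2_eq h.
by rewrite (Prop_irrelevance (projT1_eq h) erefl).
Qed.

Lemma card_leE T U (A : set T) (B : set U) :
  A #<= B <-> exists f : A -> B, injective f.
Proof.
split=> [/card_leP[f]|[f fI]].
  by exists f; apply: in2TT; exact: inj.
apply/card_leP.
have h : exists2 f' : A -> B, set_fun setT setT f' & set_inj setT f'.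
  by exists f => // x y _ _; exact: fI.
exact: (injfunPex.2 h).
Qed.

Lemma card_le_image_of T U (A : set T) (B : set U) (f : U -> T) :
  A `<=` f @` B -> A #<= B.
Proof. by move=> /subset_card_le/card_le_trans; apply; exact: card_image_le. Qed.

Section Small.

Variable kappa : V.
Hypothesis kappa_reg : regular kappa.
Hypothesis kappa_unc : ~ countable kappa.

(** Smallness is expressed by an enumeration along an element of [kappa], since
    enumerations compose and restrict; [small_card_lt] relates it to cardinality. *)
Definition small T (X : set T) :=
  exists (a : kappa) (e : val a -> T), X `<=` range e.

Lemma kappa_card : is_cardinal kappa. Proof. by case: kappa_reg. Qed.
Lemma kappa_ord : is_ordinal kappa. Proof. by case: kappa_card. Qed.

Lemma kappa_elem_ord (a : kappa) : is_ordinal (val a).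
Proof. exact: ord_elem kappa_ord (eltsP a). Qed.

Lemma kappa_elem_sub (a : kappa) x : x ∈ val a -> x ∈ kappa.
Proof. exact: ord_trans kappa_ord (eltsP a). Qed.

Lemma small_sub T (X Y : set T) : X `<=` Y -> small Y -> small X.
Proof. by move=> XY [a [e Ye]]; exists a, e; apply: subset_trans Ye. Qed.

Lemma small_image T U (f : T -> U) (X : set T) : small X -> small (f @` X).
Proof.
move=> [a [e Xe]]; exists a, (f \o e) => _ [x /Xe[i _ <-] <-].
by exists i.
Qed.

Lemma kappa_zero : exists a : kappa, forall z, ~ z ∈ val a.
Proof.
have [x xk] : kappa !=set0 by case: kappa_reg => _ /infinite_setN0.
have [z zk zmin] := wf_min elem_wf (ex_intro _ x xk).
exists (to_elts zk) => y yz; apply: (zmin y yz).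
exact: ord_trans kappa_ord zk yz.
Qed.

Lemma small0 T : small (@set0 T).
Proof.
have [a az] := kappa_zero.
by exists a, (fun i => match az _ (eltsP i) with end).
Qed.

Lemma small_exact T (X : set T) : small X ->
  exists (a : kappa) (e : val a -> T), X = range e.
Proof.
move=> [a [e Xe]]; have [[x0 Xx0]|nX] := pselect (X !=set0).
  exists a, (fun i => if pselect (X (e i)) then e i else x0).
  apply/seteqP; split=> [x Xx|_ [i _ <-]]; last by case: pselect.
  by have [i _ ex] := Xe _ Xx; exists i => //; case: pselect; rewrite ex.
have [z z0] := kappa_zero; exists z, (fun i => match z0 _ (eltsP i) with end).
apply/seteqP; split=> [x Xx|x [i]]; last by case: (z0 _ (eltsP i)).
by case: nX; exists x.
Qed.

(** Distinct elements are chosen by recursion along [kappa]; the recursion stops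
    only if an initial segment of [kappa] exhausts [Z]. *)
Lemma small_or_inj T (Z : set T) :
  small Z \/ exists c : kappa -> T, injective c /\ forall i, Z (c i).
Proof.
have [[t0 Zt0]|nZ] := pselect (Z !=set0); last first.
  left; apply: small_sub (small0 T) => t Zt; case: nZ; by exists t.
pose F (g : V) (rec : forall g', g' ∈ g -> T) :=
  the t0 [set t | Z t /\ forall g' (h : g' ∈ g), rec g' h <> t].
pose c := Fix elem_wf (fun=> T) F.
have cE g : c g = the t0 [set t | Z t /\ forall g', g' ∈ g -> c g' <> t].
  rewrite /c Fix_eq // => {g} g f f' ff'; rewrite /F; congr the.
  by apply: funext => t; apply: propext; split=> -[Zt h]; split=> // g' h';
    [rewrite -ff'|rewrite ff'].
have [[g H]|H] := pselect (exists g : kappa, forall t, Z t ->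
    exists2 g', g' ∈ val g & c g' = t).
  left; exists g, (fun i => c (val i)) => t /H[g' h <-].
  by exists (to_elts h).
have cP (g : kappa) : Z (c (val g)) /\ forall g', g' ∈ val g -> c g' <> c (val g).
  rewrite [c (val g)]cE.
  apply: (@theP _ t0 [set t | Z t /\ forall g', g' ∈ val g -> c g' <> t]).
  apply: contrapT => H'; apply: H; exists g => t Zt.
  apply: contrapT => H''; apply: H'; exists t; split=> // g' h e.
  by apply: H''; exists g'.
right; exists (fun g => c (val g)); split=> [g g' cc|g]; last by case: (cP g).
apply: val_inj.
have [h|//|h] := ord_trichotomy (kappa_elem_ord g) (kappa_elem_ord g').
  by case: (cP g') => _ /(_ _ h).
by case: (cP g) => _ /(_ _ h); rewrite cc.
Qed.

Lemma small_card_lt T (X : set T) : small X <-> card_lt X kappa.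
Proof.
split.
  move=> [a [e Xe]].
  have Xa : X #<= val a.
    rewrite -(card_le_eqr (card_setT (val a))); exact: card_le_image_of Xe.
  split.
    apply: card_le_trans Xa _; apply: subset_card_le => x.
    exact: kappa_elem_sub.
  move=> kX; have [_ /(_ _ (eltsP a))[_]] := kappa_card; apply.
  exact: card_le_trans kX Xa.
move=> [_ nX]; have [//|[c [cI cX]]] := small_or_inj X.
exfalso; apply: nX; apply/card_leE.
exists (fun i => exist _ (c i) (mem_set (cX i))) => i j [] /cI //.
Qed.

Lemma small_bounded (X : set V) : X `<=` kappa -> small X ->
  exists b : kappa, forall a, X a -> a ∈ val b.
Proof.
move=> Xk /small_card_lt lt; have [_ _ /(_ X Xk lt)[b bk Xb]] := kappa_reg.
by exists (to_elts bk).
Qed.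

(** Otherwise [kappa] embeds into the union.  The indices sent into one member of
    the family are bounded in [kappa], and by regularity so are the bounds; but a
    common bound of the bounds is an index too, and would lie below itself. *)
Lemma small_bigcup J T (Y : set J) (X : J -> set T) :
  small Y -> (forall j, Y j -> small (X j)) -> small (\bigcup_(j in Y) X j).
Proof.
move=> sY sX; have [//|[c [cI cX]]] := small_or_inj (\bigcup_(j in Y) X j).
exfalso.
have bP j : exists b : V, Y j -> b ∈ kappa /\ forall g : kappa, X j (c g) -> val g ∈ b.
  have [Yj|nYj] := pselect (Y j); last by exists V0.
  have [a [e Xe]] := sX j Yj.
  have [] := @small_bounded (val @` [set g : kappa | X j (c g)]).
  - by move=> _ [g _ <-]; exact: eltsP.
  - exists a, (fun i => the V0 [set v | exists2 g : kappa, v = val g & c g = e i]).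
    move=> _ [g Xg <-]; have [i _ ei] := Xe _ Xg; exists i => //.
    have [|g' -> cg'] := theP V0 (P := [set v | exists2 g : kappa, v = val g & c g = e i]).
      by exists (val g), g.
    by congr val; apply: cI; rewrite cg' ei.
  move=> b bX; exists (val b) => _; split; first exact: eltsP.
  by move=> g Xg; apply: bX; exists g.
have [b {}bP] := choice bP.
have [] := @small_bounded (b @` Y).
- by move=> _ [j /bP[]] bk _ <-.
- exact: small_image.
move=> b' b'P; have [j Yj /(proj2 (bP j Yj)) h] := cX b'.
by apply: elem_asym h (b'P _ _); exists j.
Qed.

Lemma kappa_limit (a : kappa) : exists b : kappa, val a ∈ val b.
Proof.
have [] := @small_bounded [set val a].
- by move=> _ ->; exact: eltsP.
- apply/small_card_lt; split.
    by apply: subset_card_le => _ ->; exact: eltsP.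
  move=> h; have [_ inf _] := kappa_reg; apply: inf.
  exact: card_le_finite h (finite_set1 _).
by move=> b bP; exists b; apply: bP.
Qed.

(** The uncountability of [kappa] enters here; it makes the filters below countably
    complete. *)
Lemma small_countable T (X : set T) : countable X -> small X.
Proof.
move=> cX; apply/small_card_lt; split.
  apply: card_le_trans cX _; apply/infiniteP.
  by have [_ inf _] := kappa_reg.
by move=> kX; apply: kappa_unc; apply: card_le_trans cX.
Qed.

Lemma small_finite T (X : set T) : finite_set X -> small X.
Proof. by move=> /finite_set_countable; exact: small_countable. Qed.

Lemma small1 T (x : T) : small [set x].
Proof. exact: small_finite. Qed.

Lemma smallU T (X Y : set T) : small X -> small Y -> small (X `|` Y).
Proof.
move=> sX sY; apply: (@small_sub _ _ (\bigcup_(b in [set: bool]) if b then X else Y)).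
  by move=> x [Xx|Yx]; [exists true|exists false].
apply: small_bigcup; first exact: small_finite.
by case.
Qed.

Lemma small_elem (a : kappa) : small (val a).
Proof. by exists a, val => x xa; exists (to_elts xa). Qed.

Lemma small_elem_type (a : kappa) : small [set: val a].
Proof. by exists a, id => x; exists x. Qed.

Lemma kappa_two : exists (a : kappa) (i j : val a), i <> j.
Proof.
have [a _] := kappa_zero; have [b ab] := kappa_limit a.
have [c bc] := kappa_limit b.
exists c, (to_elts (ord_trans (kappa_elem_ord c) bc ab)), (to_elts bc).
move=> /(f_equal val) e; have {e} e : val a = val b := e.
by move: ab; rewrite e; exact: elem_irrefl.
Qed.

End Small.

(** Trees with branching given by elements of [kappa]: the terms over
    operations of arity less than [kappa]. *)
Inductive wtree (kappa : V) (G : Type) (ar : G -> kappa) :=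
| wnode (g : G) (s : val (ar g) -> wtree ar).

Fixpoint wfold (kappa : V) (G : Type) (ar : G -> kappa) (T : Type)
    (op : forall g, (val (ar g) -> T) -> T) (t : wtree ar) : T :=
  let: wnode g s := t in op g (fun i => wfold op (s i)).

Section Codes.

Variables kappa lambda : V.
Hypothesis kappa_reg : regular kappa.
Hypothesis kappa_lambda : kappa `<=` lambda.
Hypothesis lambda_seq : [set: lt_seq kappa lambda] #= lambda.

Definition lam_le (T : Type) := exists c : T -> lambda, injective c.

Definition klam (a : kappa) : lambda := to_elts (kappa_lambda (eltsP a)).

Lemma klam_inj : injective klam.
Proof. by move=> a b [] /val_inj. Qed.

Lemma lam_le_inj T U (f : T -> U) : injective f -> lam_le U -> lam_le T.
Proof. by move=> fI [c cI]; exists (c \o f); exact: inj_comp. Qed.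

Lemma lam_le_lam : lam_le lambda. Proof. by exists id. Qed.

Lemma lam_le_kappa : lam_le kappa. Proof. by exists klam; exact: klam_inj. Qed.

Lemma lam_le_lt_seq : lam_le (lt_seq kappa lambda).
Proof.
have : [set: lt_seq kappa lambda] #<= lambda by have [] := (card_eqPle _ _).1 lambda_seq.
move=> /card_leE[f fI].
by exists (f \o to_setT) => s t /= /fI/(f_equal val).
Qed.

Lemma lam_le_seq T : lam_le T -> lam_le {a : kappa & val a -> T}.
Proof.
move=> [c cI].
apply: (lam_le_inj (f := fun s : {a : kappa & val a -> T} =>
  existT (fun a : kappa => val a -> lambda) (projT1 s) (c \o projT2 s))).
  move=> [a s] [b t] /= e; have /= ab := projT1_eq e; subst b.
  congr existT; apply: funext => i; apply: cI.
  by have /(f_equal (fun f => f i)) := existT_inj e.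
exact: lam_le_lt_seq.
Qed.

(** A pair is a sequence along an element of [kappa] that takes one value at [i] and
    the other value elsewhere. *)
Lemma lam_le_prod T U : lam_le T -> lam_le U -> lam_le (T * U).
Proof.
move=> [c cI] [d dI]; have [a [i [j ij]]] := kappa_two kappa_reg.
apply: (lam_le_inj (f := fun p => existT (fun a : kappa => val a -> lambda) a
  (fun k => if pselect (k = i) then c p.1 else d p.2))); last exact: lam_le_lt_seq.
move=> [t u] [t' u'] /= h; have e := existT_inj h; congr pair.
  have := f_equal (fun f => f i) e => /=.
  by case: pselect => //= _; exact: cI.
have := f_equal (fun f => f j) e => /=.
by case: pselect => /= [/esym //|_]; exact: dI.
Qed.

Lemma lam_le_bool : lam_le bool.
Proof.
have [a [i [j ij]]] := kappa_two kappa_reg.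
pose f (k : val a) := klam (to_elts (kappa_elem_sub kappa_reg (eltsP k))).
have fI : injective f by move=> k l [] /val_inj.
by exists (fun b => if b then f i else f j) => -[] [] // /fI // /esym.
Qed.

Lemma lambda_inh : exists x : lambda, True.
Proof. by have [c _] := lam_le_bool; exists (c true). Qed.

Lemma lam_le_sum T U : lam_le T -> lam_le U -> lam_le (T + U).
Proof.
move=> [c cI] [d dI]; have [x _] := lambda_inh.
apply: (lam_le_inj (f := fun s => match s with
  | inl t => (true, c t) | inr u => (false, d u) end)).
  by move=> [t|u] [t'|u'] [] // => [/cI|/dI] ->.
exact: lam_le_prod lam_le_bool lam_le_lam.
Qed.

Lemma lam_le_unit : lam_le unit.
Proof. by have [x _] := lambda_inh; exists (fun=> x) => -[] []. Qed.

Lemma lam_le_option T : lam_le T -> lam_le (option T).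
Proof.
move=> lT; apply: (lam_le_inj (f := fun o => if o is Some t then inl t else inr tt)).
  by move=> [t|] [u|] // [] ->.
exact: lam_le_sum lT lam_le_unit.
Qed.

Lemma lam_le_nat : lam_le nat.
Proof.
have [_ inf _] := kappa_reg; have /card_leE[f fI] := (infiniteP _).1 inf.
exists (klam \o f \o to_setT) => m n /=.
by move=> /klam_inj/fI/(f_equal val).
Qed.

(** Since [lambda] absorbs sequences of length less than [kappa], terms can be
    coded by structural recursion. *)
Lemma lam_le_wtree G (ar : G -> kappa) : lam_le G -> lam_le (wtree ar).
Proof.
move=> lG; have [c cI] := lam_le_prod lG lam_le_lam.
have [sq sqI] := lam_le_lt_seq.
pose fix code (t : wtree ar) : lambda := let: wnode g s := t in
  c (g, sq (existT (fun a : kappa => val a -> lambda) (ar g) (fun i => code (s i)))).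
exists code; elim=> g s IH [g' s'] /= /cI [] e; subst g' => /sqI h.
have {h}e := existT_inj h.
congr wnode; apply: funext => i; apply: IH.
by have := f_equal (fun f => f i) e.
Qed.

Lemma lam_le_small_set T : lam_le T ->
  exists c : set T -> lambda, forall X Y, small kappa X -> small kappa Y ->
    c X = c Y -> X = Y.
Proof.
move=> lT; have [c cI] := lam_le_seq lT; have [x _] := lambda_inh.
pose P X (s : {a : kappa & val a -> T}) := X = range (projT2 s).
exists (fun X => the x [set y | exists2 s, P X s & y = c s]) => X Y sX sY.
have ex Z : small kappa Z -> [set y | exists2 s, P Z s & y = c s] !=set0.
  by move=> /(small_exact kappa_reg)[a [e ->]]; exists (c (existT _ a e)), (existT _ a e).
have [s Xs ->] := theP x (ex X sX); have [t Yt ->] := theP x (ex Y sY).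
by move=> /cI st; rewrite Xs Yt st.
Qed.

End Codes.

(** * Normal filters from coherent values *)

Section Filters.

Variables kappa lambda : V.
Hypothesis kappa_reg : regular kappa.
Hypothesis kappa_unc : ~ countable kappa.
Hypothesis kappa_lambda : kappa `<=` lambda.
Hypothesis lambda_seq : [set: lt_seq kappa lambda] #= lambda.

Notation small := (small kappa).
Notation lam_le := (lam_le lambda).
Notation klam := (klam kappa_lambda).

Definition kel (a : kappa) (k : val a) : lambda :=
  klam (to_elts (kappa_elem_sub kappa_reg (eltsP k))).

Lemma kel_inj a : injective (@kel a).
Proof. by move=> k l [] /val_inj. Qed.

Lemma kel_neq (a : kappa) (k : val a) : kel k <> klam a.
Proof.
move=> /(f_equal val) e; have {}e : val k = val a := e.
by have := eltsP k; rewrite e; exact: elem_irrefl.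
Qed.

(** The trace on [kappa] has to be an ordinal so that the membership of one [a] in
    [kappa] entails that of all smaller ordinals: a condition on the fewer than
    [kappa] many elements of [a] becomes a condition on one element. *)
Definition idx_set (x : set lambda) :=
  small x /\ forall a b : lambda, x a -> val a ∈ kappa -> val b ∈ val a -> x b.

Lemma idx_set_cover x : small x -> exists2 y, idx_set y & x `<=` y.
Proof.
move=> sx.
have [] := @small_bounded _ kappa_reg (kappa `&` (val @` x)).
- by move=> v [].
- by apply: small_sub (small_image val sx) => v [].
move=> b bP; exists (x `|` [set c : lambda | val c ∈ val b]); last by left.
split.
  apply: smallU => //; exists b, (@kel b) => c cb.
  by exists (to_elts cb) => //; apply: val_inj.
move=> a c xa ak ca; right => /=.
have ab : val a ∈ val b.
  by case: xa => //= xa; apply: bP; split=> //; exists a.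
exact: ord_trans (kappa_elem_ord kappa_reg b) ab ca.
Qed.

(** [E i a] stands for f_i(d) = a, where [d] is an ideal element of [P_kappa lambda]
    that contains every element of [lambda] and no other: a value of f_i at [d]
    which belongs to [d] is therefore an element of [lambda]. *)
Definition coherent_values := forall (J : Type), lam_le J ->
  forall f : J -> set lambda -> lambda, exists E : J -> lambda -> Prop,
  [/\ forall i c, (forall x, idx_set x -> x c -> x (f i x)) -> exists a, E i a,
      forall i j a b c, E i a -> E j b ->
        exists x, [/\ idx_set x, x c, f i x = a & f j x = b] &
      forall i j a, E i a -> (forall x, idx_set x -> f i x = a -> x (f j x)) ->
        exists b, E j b].

Definition fine_filter (U : set (set (set lambda))) :=
  [/\ U idx_set,
      forall X Y : set (set lambda), X `<=` Y -> U X -> U Y,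
      ~ U set0,
      forall (a : kappa) (X : val a -> set (set lambda)),
        (forall i, U (X i)) -> U (\bigcap_i X i) &
      forall c, U [set x | x c]].

(** Asking for a filter on all of [P_kappa lambda], and not for an ultrafilter on a
    field of [lambda] many sets, avoids any reference to that field; the sets that
    have to be decided are handled in [normal_filters_diag]. *)
Definition normal_filters := forall (J : Type), lam_le J ->
  forall f : J -> set lambda -> lambda, exists2 U, fine_filter U &
  forall j, U [set x | x (f j x)] -> exists a, U [set x | f j x = a].

Section Coherent.

Variables (J : Type) (f : J -> set lambda -> lambda).

Let zero : kappa := projT1 (cid (kappa_zero kappa_reg)).

Lemma lam_other (c : lambda) : exists c' : lambda, c' <> c.
Proof.
have [a [i [j ij]]] := kappa_two kappa_reg.
have [e|] := pselect (kel i = c); last by exists (kel i).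
by exists (kel j); rewrite -e => /kel_inj/esym.
Qed.

Let gen : Type := (J + lambda + {a : kappa & val a -> lambda})%type.

Let gen_ar (g : gen) : kappa :=
  match g with inl _ => zero | inr p => projT1 p end.

(* The three operations are: the functions [f]; for each [c], a function whose
   value is [c] exactly when [c] belongs to [x]; and a test of the equations
   r k = v k, with value [a] if all of them hold and otherwise an element of [a]
   at which one fails.  As an ordinal is not an element of itself, the value
   tells the two cases apart. *)
Let gen_op (g : gen) (x : set lambda) : (val (gen_ar g) -> lambda) -> lambda :=
  match g with
  | inl (inl j) => fun=> f j x
  | inl (inr c) => fun=> if pselect (x c) then c else projT1 (cid (lam_other c))
  | inr p => fun r =>
      if pselect (exists k, r k <> projT2 p k) is left h
      then kel (projT1 (cid h)) else klam (projT1 p)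
  end.

Let gen_val : wtree gen_ar -> set lambda -> lambda :=
  wfold (fun g r x => @gen_op g x (fun i => r i x)).

(** The filter is generated by the sets { x | F_i(x) = a } with [E i a], where [F]
    is the closure of [f].  Completeness: the test of the equations that define
    fewer than [kappa] many generators takes its value in [x] as soon as [a] is in
    [x], so it has a value at the ideal element; that value cannot point to an
    equation that fails, because the equation holds at the ideal element. *)
Lemma coherent_normal : lam_le J -> coherent_values -> exists2 U, fine_filter U &
  forall j, U [set x | x (f j x)] -> exists a, U [set x | f j x = a].
Proof.
move=> lJ H.
have lI : lam_le (wtree gen_ar).
  apply: (lam_le_wtree kappa_reg lambda_seq).
  apply: (lam_le_sum kappa_reg kappa_lambda lambda_seq).
    by apply: (lam_le_sum kappa_reg kappa_lambda lambda_seq) => //; exact: lam_le_lam.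
  exact: lam_le_lt_seq.
have [E [Ecof Econs Enorm]] := H _ lI gen_val.
pose leaf j := @wnode kappa gen gen_ar (inl (inl j))
  (fun i => match projT2 (cid (kappa_zero kappa_reg)) _ (eltsP i) with end).
pose ind c := @wnode kappa gen gen_ar (inl (inr c))
  (fun i => match projT2 (cid (kappa_zero kappa_reg)) _ (eltsP i) with end).
pose nd a v s := @wnode kappa gen gen_ar (inr (existT _ a v)) s.
pose U (X : set (set lambda)) := exists i a, E i a /\
  forall x, idx_set x -> gen_val i x = a -> X x.
have Ucap (a : kappa) (X : val a -> set (set lambda)) :
    (forall i, U (X i)) -> U (\bigcap_i X i).
  move=> UX; have [s sP] := choice UX; have [v vP] := choice sP.
  pose t := nd a v s.
  have tE x : gen_val t x = if pselect (exists k, gen_val (s k) x <> v k) is left h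
      then kel (projT1 (cid h)) else klam a by [].
  have [|b Eb] := Ecof t (klam a).
    move=> x [sx tx] xa; rewrite tE; case: pselect => // h.
    apply: tx xa _ _; first exact: eltsP.
    exact: eltsP (projT1 (cid h)).
  have [be|nbe] := pselect (b = klam a).
    exists t, b; split=> // x ix; rewrite tE be.
    case: pselect => [h /kel_neq //|h _] i _.
    apply: (proj2 (vP i)) => //; apply: contrapT => ne; apply: h.
    by exists i.
  have [x [ix _ tx _]] := Econs _ _ _ _ b Eb Eb.
  move: tx; rewrite tE; case: pselect => [h hb|_ /esym //].
  pose k := projT1 (cid h).
  have [y [iy _ ty sy]] := Econs _ _ _ _ b Eb (proj1 (vP k)).
  move: ty; rewrite tE; case: pselect => [h' hb'|_ /esym //].
  case: (projT2 (cid h')).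
  have -> : projT1 (cid h') = k by apply: kel_inj; rewrite hb' hb.
  exact: sy.
have Usub (X Y : set (set lambda)) : X `<=` Y -> U X -> U Y.
  by move=> XY [i [a [Ea h]]]; exists i, a; split=> // x ix /(h x ix)/XY.
have U1 : U idx_set.
  have : U (\bigcap_(i : val zero) idx_set).
    by apply: Ucap => i; case: (projT2 (cid (kappa_zero kappa_reg)) _ (eltsP i)).
  by move=> [i [a [Ea _]]]; exists i, a.
exists U; first split=> //.
- by move=> [i [a [Ea h]]]; have [x [ix _ xa _]] := Econs _ _ _ _ a Ea Ea;
    apply: h ix xa.
- move=> c.
  have tE x : gen_val (ind c) x =
    if pselect (x c) then c else projT1 (cid (lam_other c)) by [].
  have [|b Eb] := Ecof (ind c) c; first by move=> x _ xc; rewrite tE; case: pselect.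
  have bc : b = c.
    have [x [_ xc <- _]] := Econs _ _ _ _ c Eb Eb.
    by rewrite tE; case: pselect.
  exists (ind c), c; split=> [|x _]; first by rewrite -{2}bc.
  rewrite tE; case: pselect => // nc e.
  by case: (projT2 (cid (lam_other c))).
- move=> j [i [a [Ea h]]].
  have [|b Eb] := Enorm i (leaf j) a Ea; first by move=> x ix /(h x ix).
  by exists b, (leaf j), b.
Qed.

End Coherent.

Lemma coherent_values_normal : coherent_values -> normal_filters.
Proof. by move=> H J lJ f; apply: coherent_normal. Qed.

Section FilterTheory.

Variable U : set (set (set lambda)).
Hypothesis UF : fine_filter U.

Lemma filt_sub (X Y : set (set lambda)) : X `<=` Y -> U X -> U Y.
Proof. by case: UF => _ + _ _ _; apply. Qed.

Lemma filt_bigcap J (D : set J) (X : J -> set (set lambda)) :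
  small D -> (forall j, D j -> U (X j)) -> U (\bigcap_(j in D) X j).
Proof.
move=> /(small_exact kappa_reg)[a [e De]] UX.
case: UF => _ sub _ cap _; apply: sub (cap a (X \o e) _).
  by move=> x h j; rewrite De => -[i _ <-]; apply: h.
by move=> i; apply: UX; rewrite De; exists i.
Qed.

Lemma filtI (X Y : set (set lambda)) : U X -> U Y -> U (X `&` Y).
Proof.
move=> UX UY.
apply: (@filt_sub (\bigcap_(b in [set: bool]) if b then X else Y)).
  by move=> x h; split; [apply: (h true)|apply: (h false)].
by apply: filt_bigcap => [|[]//]; apply: small_finite.
Qed.

Lemma filt_idx : U idx_set. Proof. by case: UF. Qed.

Lemma filt_mem c : U [set x | x c]. Proof. by case: UF. Qed.

Lemma filt_all (X : set (set lambda)) : (forall x, idx_set x -> X x) -> U X.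
Proof. by move=> h; apply: filt_sub filt_idx. Qed.

Lemma filt_ex (X : set (set lambda)) : U X -> exists2 x, idx_set x & X x.
Proof.
move=> UX; apply: contrapT => H; case: UF => _ _ h _ _; apply: h.
by apply: filt_sub (filtI filt_idx UX) => x [ix Xx]; case: H; exists x.
Qed.

Lemma filtC (X : set (set lambda)) : U X -> ~ U (~` X).
Proof. by move=> UX UC; have [x _ []] := filt_ex (filtI UX UC). Qed.

Definition decides (X : set (set lambda)) := U X \/ U (~` X).

Lemma decidesN X : decides X -> (U (~` X) <-> ~ U X).
Proof. by move=> d; split=> [UC UX|nU]; [apply: filtC UX UC|case: d]. Qed.

End FilterTheory.

(** Besides being normal for the functions [f], the filter can be made to decide
    the sets [B] and to be closed under the diagonal intersections [R].  A set is
    decided because the function that takes one value on it and another value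
    elsewhere is regressive on almost every [x].  If a diagonal intersection were
    not in the filter, a regressive function would choose counterexamples, and its
    constant value would be a counterexample for almost every [x]. *)
Lemma normal_filters_diag : normal_filters ->
  forall (JB JF JR : Type), lam_le JB -> lam_le JF -> lam_le JR ->
  forall (B : JB -> set (set lambda)) (f : JF -> set lambda -> lambda)
         (R : JR -> lambda -> set (set lambda)),
  exists U, [/\ fine_filter U,
    forall j, decides U (B j),
    forall j, U [set x | x (f j x)] -> exists a, U [set x | f j x = a] &
    forall j, (forall c, U (R j c)) -> U [set x | forall c, x c -> R j c x]].
Proof.
move=> H JB JF JR lB lF lR B f R.
have [a0 _] := lambda_inh kappa_reg kappa_lambda.
have [a1 a01] := lam_other a0.
pose D j := [set x : set lambda | forall c, x c -> R j c x].
pose ind (X : set (set lambda)) x := if pselect (X x) then a0 else a1.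
pose F (j : JB + JR + JF + JR) (x : set lambda) := match j with
  | inl (inl (inl j)) => ind (B j) x
  | inl (inl (inr j)) => ind (D j) x
  | inl (inr j) => f j x
  | inr j => the a0 [set c | x c /\ ~ R j c x] end.
have [|U UF UN] := H (JB + JR + JF + JR)%type _ F.
  by do !apply: (lam_le_sum kappa_reg kappa_lambda lambda_seq).
have dec X : ((U [set x | x (ind X x)]) -> exists a, U [set x | ind X x = a]) ->
    decides U X.
  case.
    apply: (filt_sub UF) (filtI UF (filt_mem UF a0) (filt_mem UF a1)).
    by move=> x [xa0 xa1] /=; rewrite /ind; case: pselect.
  move=> a Ua; have [e|ne] := pselect (a = a0); [left|right];
    apply: filt_sub Ua => // x /=; rewrite /ind; case: pselect => //.
  - by move=> nX /= e'; case: a01; rewrite e'.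
  - by move=> xX /= e'; case: ne.
exists U; split=> // [j|j|j UR].
- by apply: dec; apply: (UN (inl (inl (inl j)))).
- exact: (UN (inl (inr j))).
- have : decides U (D j) by apply: dec; apply: (UN (inl (inl (inr j)))).
  case=> // UC.
  have Fb x : (~` D j) x -> x (F (inr j) x) /\ ~ R j (F (inr j) x) x.
    move=> h; apply: (@theP _ a0 [set c | x c /\ ~ R j c x]).
    apply: contrapT => H'; apply: h => c xc; apply: contrapT => nR.
    by apply: H'; exists c.
  have [|c Uc] := UN (inr j).
    by apply: filt_sub UC => // x /Fb[].
  exfalso; apply: (filtC UF (UR c)).
  apply: (filt_sub UF) (filtI UF UC Uc) => x [/Fb[_ h] e] Rc.
  by apply: h; move: e => /= ->.
Qed.

End Filters.

(** * Coherent values from type omission *)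

(** The properties through which the arguments below apply to both logics. *)
Record small_logic (kappa lambda : V) (l : logic) : Prop := SmallLogic {
  sl_var : lam_le lambda (var l);
  sl_len : lam_le lambda (len l);
  sl_idx : forall n : len l, small kappa [set: idx n];
  sl_two : exists (n : len l) (i j : idx n), i <> j;
  sl_inh : exists x : var l, True }.

Section Conj.

Variables (L : language) (l : logic) (n : len l) (i0 j0 : idx n).
Hypothesis ij : i0 <> j0.

(** The binary conjunction in a logic whose conjunctions are families: the second
    conjunct is repeated at all the indices other than [i0]. *)
Definition conjunction (phi psi : formula L l) : formula L l :=
  And (fun i : idx n => if `[< i = i0 >] then phi else psi).

Lemma sat_conj A s phi psi :
  @sat L l A s (conjunction phi psi) <-> sat s phi /\ sat s psi.
Proof.
split=> /= [h|[h1 h2] i]; last by case: asboolP.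
split; first by have := h i0; case: asboolP.
by have := h j0; case: asboolP => // /esym.
Qed.

Lemma free_vars_conj phi psi :
  free_vars phi = set0 -> free_vars psi = set0 -> free_vars (conjunction phi psi) = set0.
Proof.
by move=> h1 h2; apply: bigcup0 => i _ /=; case: asboolP.
Qed.

End Conj.

Section Compact.

Variables kappa lambda : V.
Hypothesis kappa_reg : regular kappa.
Hypothesis kappa_unc : ~ countable kappa.
Hypothesis kappa_lambda : kappa `<=` lambda.
Hypothesis lambda_seq : [set: lt_seq kappa lambda] #= lambda.

Notation small := (small kappa).
Notation lam_le := (lam_le lambda).
Notation idx_set := (@idx_set kappa lambda).

Variable l : logic.
Hypothesis sl : small_logic kappa lambda l.
Hypothesis cto : compact_type_omission kappa l lambda.

Section Family.

Variables (J : Type) (f : J -> set lambda -> lambda).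
Hypothesis lJ : lam_le J.

Let L : language := @Language (J + lambda) (fun=> 0) unit (fun=> 1).

Let v0 : var l := projT1 (cid (sl_inh sl)).

Let cst (g : J + lambda) : term L l := @App L l g (fun=> Var L v0).

Let ival (A : structure L) (g : J + lambda) : dom A :=
  @fun_int L A g (fun i : 'I_0 => match notF (ltn_ord i) with end).

Let eval_cst A s g : @eval L l A s (cst g) = ival A g.
Proof. by congr fun_int; apply: funext => -[]. Qed.

Let term_vars_cst g : term_vars (cst g) = set0.
Proof. by apply: bigcup0 => -[]. Qed.

Let Dt (t : term L l) : formula L l := @Rel L l tt (fun=> t).
Let Dv := Dt (Var L v0).
Let neq c := Neg (Eq (Var L v0) (cst (inr c))).

Let Ax (x : set lambda) : structure L := @Structure L lambda
  (fun g _ => match g with inl j => f j x | inr c => c end)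
  (fun _ a => x (a ord0)).

Let above c (phi : formula L l) :=
  forall x, idx_set x -> x c -> forall s : var l -> dom (Ax x), sat s phi.

Let T := [set phi : formula L l | free_vars phi = set0 /\ exists c, above c phi].
Let p := [set phi : formula L l | phi = Dv \/ exists c, phi = neq c].

Let z (y : set (formula L l)) := [set c | y (neq c)].

(* If [y] is nice, the structure [Ax (z y)] is a model of the sentences in [y] and
   omits the formulas of the type in [y]: the elements of its predicate are the
   [c] for which the formula v <> c belongs to [y]. *)
Let nice (y : set (formula L l)) := [/\ Pk kappa (T `|` p) y, y Dv, idx_set (z y) &
  forall phi, y phi -> T phi -> exists2 c, z y c & above c phi].

Let neq_inj c c' : neq c = neq c' -> c = c'.
Proof. by rewrite /neq => -[]. Qed.

Let DvT : ~ T Dv.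
Proof.
move=> [h _]; have : free_vars Dv v0 by exists ord0.
by rewrite h.
Qed.

Let neqT c : ~ T (neq c).
Proof.
move=> [h _]; have : free_vars (neq c) v0 by left.
by rewrite h.
Qed.

(** Adding to [y] the formulas v <> c for all [c] in an index set that contains what
    the sentences of [y] require produces a nice set in one step. *)
Let nice_club : club kappa (T `|` p) nice.
Proof.
split.
- by move=> y [].
- move=> x [xX /(small_card_lt kappa_reg) sx].
  have [c0 _] := lambda_inh kappa_reg kappa_lambda.
  pose g phi := the c0 [set c | above c phi].
  have sz : small (z x).
    apply: small_sub (small_image (fun phi => the c0 [set c | phi = neq c]) sx).
    move=> c xc; exists (neq c) => //; apply/esym/neq_inj.
    by apply: (@theP _ c0 [set c' | neq c = neq c']); exists c.
  have [w iw zw] := idx_set_cover kappa_reg kappa_unc kappa_lambda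
    (smallU kappa_reg kappa_unc sz (small_image g sx)).
  exists (x `|` [set Dv] `|` neq @` w); last by move=> phi ?; left; left.
  have zE : z (x `|` [set Dv] `|` neq @` w) = w.
    apply/seteqP; split=> c.
      by move=> [[xc|//]|[c' wc /neq_inj <-] //]; apply: zw; left.
    by move=> wc; right; exists c.
  split; rewrite ?zE //.
  + split.
      move=> phi [[/xX //|->]|[c _ <-]]; first by right; left.
      by right; right; exists c.
    apply/small_card_lt => //; apply: smallU => //; last exact: small_image iw.1.
    by apply: smallU => //; apply: small1.
  + by left; right.
  + move=> phi [[xphi|->]|[c _ <-]]; [|by move/DvT|by move/neqT].
    move=> [_ h]; exists (g phi); last exact: (theP c0 h).
    by apply: zw; right; exists phi.
- move=> a x ak [i0 ai0] nx xm.
  have sb (U : Type) (X : a -> set U) : (forall i, small (X i)) -> small (\bigcup_i X i).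
    move=> sX; apply: small_bigcup => //.
    exact: (small_elem_type (to_elts ak)).
  have xi : (\bigcup_i x i) Dv.
    by exists (to_elts ai0) => //; case: (nx (to_elts ai0)).
  have zE : z (\bigcup_i x i) = \bigcup_i z (x i) by apply/seteqP; split=> c [i]; exists i.
  split=> //.
  + split; first by move=> phi [i _ xphi]; case: (nx i) => -[h _] _ _ _; apply: h.
    apply/small_card_lt => //; apply: sb => i; apply/small_card_lt => //.
    by case: (nx i) => -[].
  + rewrite zE; split; first by apply: sb => i; case: (nx i) => _ _ [].
    move=> c d [i _ xc] ck dc; exists i => //.
    by case: (nx i) => _ _ [_ h] _; apply: h xc ck dc.
  + move=> phi [i _ xphi] Tphi; rewrite zE; case: (nx i) => _ _ _ /(_ _ xphi Tphi)[c zc h].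
    by exists c => //; exists i.
Qed.

Let L_size : has_size L lambda.
Proof.
apply/card_eqPle; split.
  have [c cI] : lam_le ((J + lambda) + unit).
    apply: (lam_le_sum kappa_reg) => //; last exact: (lam_le_unit kappa_reg).
    by apply: (lam_le_sum kappa_reg) => //; exact: lam_le_lam.
  by apply/card_leE; exists (c \o val) => x y /= /cI /val_inj.
by apply/card_leE; exists (fun c => to_setT (inl (inr c))) => c d /(f_equal val) [].
Qed.

(** A model of all the sentences that hold in [Ax x] for almost every [x] interprets
    the predicate by an ideal index set, which consists of the constants when the
    type is omitted. *)
Lemma compact_coherent : exists E : J -> lambda -> Prop,
  [/\ forall i c, (forall x, idx_set x -> x c -> x (f i x)) -> exists a, E i a,
      forall i j a b c, E i a -> E j b ->
        exists x, [/\ idx_set x, x c, f i x = a & f j x = b] &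
      forall i j a, E i a -> (forall x, idx_set x -> f i x = a -> x (f j x)) ->
        exists b, E j b].
Proof.
have [n [i0 [j0 ij]]] := sl_two sl.
have [c0 _] := lambda_inh kappa_reg kappa_lambda.
have [] := @cto L T v0 p L_size.
- by move=> phi [].
- move=> phi [->|[c ->]]; first by move=> v [].
  by rewrite -[free_vars _]/([set v0] `|` term_vars (cst (inr c))) term_vars_cst setU0.
- exists nice; first exact: nice_club.
  move=> y [_ yD iz yT]; exists (Ax (z y)).
    split; first by exists (val c0); exact: eltsP.
    by move=> phi [yphi Tphi] s; have [c zc] := yT _ yphi Tphi; apply.
  move=> a h.
  have za : z y a by apply: (h Dv); split=> //; left.
  have := h (neq a); apply.
    by split=> //; right; exists a.
  by [].
move=> A [[d Ad] AT] Ap.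
pose s (_ : var l) : dom A := to_elts Ad.
have DA i : @rel_int L A tt (fun=> ival A (inl i)) -> exists a, ival A (inl i) = ival A (inr a).
  move=> h; apply: contrapT => H; apply: (Ap (ival A (inl i))) => phi [->//|[c -> e]].
  by apply: H; exists c; rewrite -(eval_cst (fun=> ival A (inl i)) (inr c)).
have satE s' i a : @sat L l A s' (Eq (cst (inl i)) (cst (inr a))) <->
    ival A (inl i) = ival A (inr a)
  by rewrite -[sat _ _]/(eval s' (cst (inl i)) = eval s' (cst (inr a))) !eval_cst.
have satD s' i : @sat L l A s' (Dt (cst (inl i))) <->
    @rel_int L A tt (fun=> ival A (inl i)).
  rewrite -[sat _ _]/(@rel_int L A tt (fun=> eval s' (cst (inl i)))).
  by rewrite eval_cst.
have fvE i a : free_vars (Eq (cst (inl i)) (cst (inr a))) = set0.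
  rewrite -[free_vars _]/(term_vars (cst (inl i)) `|` term_vars (cst (inr a))).
  by rewrite !term_vars_cst setU0.
have fvD i : free_vars (Dt (cst (inl i))) = set0.
  by apply: bigcup0 => k _; exact: term_vars_cst.
exists (fun i a => ival A (inl i) = ival A (inr a)); split.
- move=> i c h; apply: DA; apply/(satD s); apply: AT; split; first exact: fvD.
  by exists c => x ix xc s' /=; apply: h.
- move=> i j a b c ia jb; apply: contrapT => H.
  have : T (Neg (conjunction i0 (Eq (cst (inl i)) (cst (inr a))) (Eq (cst (inl j)) (cst (inr b))))).
    split; first exact: (free_vars_conj i0 (fvE _ _) (fvE _ _)).
    exists c => x ix xc s' /= /(sat_conj ij)[/= e1 e2]; apply: H; exists x; split=> //.
  by move=> /AT /(_ s) /=; apply; apply/(sat_conj ij); split; apply/satE.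
- move=> i j a ia h; apply: DA; apply: contrapT => H.
  have : T (Neg (conjunction i0 (Eq (cst (inl i)) (cst (inr a))) (Neg (Dt (cst (inl j)))))).
    split; first exact: (free_vars_conj i0 (fvE i a) (psi := Neg (Dt (cst (inl j)))) (fvD j)).
    by exists c0 => x ix xc s' /= /(sat_conj ij)[/= e1]; apply; apply: h.
  move=> /AT /(_ s) /=; apply; apply/(sat_conj ij); split; first exact/satE.
  by move=> /satD.
Qed.

End Family.

Lemma compact_coherent_values : coherent_values kappa lambda.
Proof. by move=> J lJ f; exact: compact_coherent. Qed.

End Compact.

(** * Skolem products and the theorem of Los *)

Section SatExt.

Variables (L : language) (l : logic) (A : structure L).

Lemma eval_ext (s s' : var l -> dom A) (t : term L l) :
  (forall v, term_vars t v -> s v = s' v) -> eval s t = eval s' t.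
Proof.
elim: t => [v|f ts IH] /= h; first exact: h.
by congr fun_int; apply: funext => k; apply: IH => v kv; apply: h; exists k.
Qed.

Lemma sat_ext (s s' : var l -> dom A) (phi : formula L l) :
  (forall v, free_vars phi v -> s v = s' v) -> (sat s phi <-> sat s' phi).
Proof.
elim: phi s s' => [t u|r ts|phi IH|n phis IH|n xs phi IH] s s' /= h.
- by rewrite (@eval_ext s s') 1?(@eval_ext s s' u) // => v tv; apply: h; [right|left].
- rewrite (_ : (fun i => eval s (ts i)) = (fun i => eval s' (ts i))) //.
  by apply: funext => k; apply: eval_ext => v kv; apply: h; exists k.
- by rewrite (IH s s').
- have h' i v : free_vars (phis i) v -> s v = s' v by move=> iv; apply: h; exists i.
  by split=> H i; have [h1 h2] := IH i s s' (h' i); auto.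
- have half (s1 s2 : var l -> dom A) : (forall v, free_vars phi v /\ ~ range xs v -> s1 v = s2 v) ->
      (exists2 s0, (forall v, ~ range xs v -> s0 v = s1 v) & sat s0 phi) ->
      exists2 s0, (forall v, ~ range xs v -> s0 v = s2 v) & sat s0 phi.
    move=> e [s0 s01 s0phi].
    pose s3 v := if `[< range xs v >] then s0 v else s2 v.
    have [h3 _] : sat s0 phi <-> sat s3 phi.
      by apply: IH => v pv; rewrite /s3; case: asboolP => // nv; rewrite s01 // e.
    by exists s3 => [v nv|]; [rewrite /s3; case: asboolP|exact: h3].
  by split; apply: half => // v hv; apply/esym; exact: h.
Qed.

End SatExt.

Section Los.

Variables kappa lambda : V.
Hypothesis kappa_reg : regular kappa.
Hypothesis kappa_unc : ~ countable kappa.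
Hypothesis kappa_lambda : kappa `<=` lambda.
Hypothesis lambda_seq : [set: lt_seq kappa lambda] #= lambda.

Notation small := (small kappa).
Notation lam_le := (lam_le lambda).
Notation idx_set := (@idx_set kappa lambda).

Let lsum := lam_le_sum kappa_reg kappa_lambda lambda_seq.
Let lprod := lam_le_prod kappa_reg lambda_seq.

Variable l : logic.
Hypothesis sl : small_logic kappa lambda l.

(** Along an enumeration of [X] by an element of [kappa], functions on [X] become
    short sequences. *)
Lemma lam_le_small_fun X T : small [set: X] -> lam_le T -> lam_le (X -> T).
Proof.
move=> [a [e Xe]] lT.
apply: (lam_le_inj (f := fun g : X -> T =>
  existT (fun a : kappa => val a -> T) a (g \o e))); last exact: lam_le_seq.
move=> g g' h; apply: funext => x; have [k _ <-] := Xe x I.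
by have := f_equal (fun f => f k) (existT_inj h).
Qed.

Section Formulas.

Variable L : language.
Hypothesis lL : lam_le (fun_sym L + rel_sym L).

Lemma small_ord n : small [set: 'I_n].
Proof. exact/(small_finite kappa_reg kappa_unc)/finite_finset. Qed.

Lemma lam_le_fun_sym : lam_le (fun_sym L).
Proof. by apply: (lam_le_inj (f := inl)) lL => x y []. Qed.

Lemma lam_le_rel_sym : lam_le (rel_sym L).
Proof. by apply: (lam_le_inj (f := inr)) lL => x y []. Qed.

Lemma lam_le_term : lam_le (term L l).
Proof.
have [c cI] : lam_le (var l + fun_sym L * lambda).
  apply: lsum; first exact: sl_var sl.
  by apply: lprod; [exact: lam_le_fun_sym|exact: lam_le_lam].
pose d n := projT1 (cid (lam_le_small_fun (small_ord n) (lam_le_lam lambda))).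
have dI n : injective (d n) := projT2 (cid (lam_le_small_fun (small_ord n) (lam_le_lam lambda))).
pose fix code (t : term L l) : lambda := match t with
  | Var x => c (inl x)
  | App f ts => c (inr (f, d _ (fun k => code (ts k)))) end.
exists code; elim=> [x|f ts IH] [x'|f' ts'] //= /cI; first by move=> [->].
  by [].
  by [].
move=> [] e; subst f' => /dI h; congr App; apply: funext => k; apply: IH.
by have := f_equal (fun g => g k) h.
Qed.

Lemma lam_le_formula : lam_le (formula L l).
Proof.
have [t tI] := lam_le_term.
have [c cI] : lam_le (lambda * lambda + rel_sym L * lambda + lambda +
    len l * lambda + len l * (lambda * lambda)).
  have h := lam_le_lam lambda; have hl := sl_len sl; have hr := lam_le_rel_sym.
  by do !apply: lsum => //; do !apply: lprod => //.
pose d n := projT1 (cid (lam_le_small_fun (small_ord n) (lam_le_lam lambda))).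
have dI n : injective (d n) := projT2 (cid (lam_le_small_fun (small_ord n) (lam_le_lam lambda))).
pose e n := projT1 (cid (lam_le_small_fun (sl_idx sl n) (lam_le_lam lambda))).
have eI n : injective (e n) := projT2 (cid (lam_le_small_fun (sl_idx sl n) (lam_le_lam lambda))).
pose v n := projT1 (cid (lam_le_small_fun (sl_idx sl n) (sl_var sl))).
have vI n : injective (v n) := projT2 (cid (lam_le_small_fun (sl_idx sl n) (sl_var sl))).
pose fix code (phi : formula L l) : lambda := match phi with
  | Eq t1 t2 => c (inl (inl (inl (inl (t t1, t t2)))))
  | Rel r ts => c (inl (inl (inl (inr (r, d _ (fun k => t (ts k)))))))
  | Neg phi => c (inl (inl (inr (code phi))))
  | And n phis => c (inl (inr (n, e _ (fun k => code (phis k)))))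
  | Ex n xs phi => c (inr (n, (v _ xs, code phi))) end.
exists code; elim=> [t1 t2|r ts|phi IH|n phis IH|n xs phi IH]
  [t1' t2'|r' ts'|phi'|n' phis'|n' xs' phi'] //= /cI [] //.
- by move=> /tI -> /tI ->.
- move=> h; subst r' => /dI h; congr Rel; apply: funext => k; apply: tI.
  by have := f_equal (fun g => g k) h.
- by move=> /IH ->.
- move=> h; subst n' => /eI h; congr And; apply: funext => k; apply: IH.
  by have := f_equal (fun g => g k) h.
- by move=> h; subst n' => /vI -> /IH ->.
Qed.

Lemma small_term_vars (t : term L l) : small (term_vars t).
Proof.
elim: t => [x|f ts IH] /=; first exact: small1.
by apply: small_bigcup => //; exact: small_ord.
Qed.

Lemma small_free_vars (phi : formula L l) : small (free_vars phi).
Proof.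
elim: phi => [t u|r ts|phi IH|n phis IH|n xs phi IH] //=.
- by apply: smallU => //; exact: small_term_vars.
- by apply: small_bigcup => // [|k _]; [exact: small_ord|exact: small_term_vars].
- by apply: small_bigcup => //; exact: sl_idx sl n.
- by apply: small_sub IH => x [].
Qed.

Variable A : set lambda -> structure L.
Variable d0 : forall x, dom (A x).
Variables (H : Type) (h : H -> forall x, dom (A x)).
Hypothesis lH : lam_le H.

Definition cover_dom T (X : set T) (sX : small X) : kappa := projT1 (cid sX).
Definition cover_map T (X : set T) (sX : small X) : val (cover_dom sX) -> T :=
  projT1 (cid (projT2 (cid sX))).

Lemma cover_mapP T (X : set T) (sX : small X) x : X x -> exists k, @cover_map _ _ sX k = x.
Proof.
by move=> /(projT2 (cid (projT2 (cid sX)))) [k _ <-]; exists k.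
Qed.

Definition decode K T D (d : D) (e : K -> T) (r : K -> D) (t : T) : D :=
  if pselect (exists k, e k = t) is left ex then r (projT1 (cid ex)) else d.

Lemma decodeE K T D (d : D) (e : K -> T) (g : T -> D) t :
  (exists k, e k = t) -> decode d e (g \o e) t = g t.
Proof. by rewrite /decode; case: pselect => // ex _ /=; case: cid => k /= ->. Qed.

Definition skolem (B : structure L) (s : var l -> dom B) (phi : formula L l)
    : var l -> dom B :=
  match phi with
  | Ex n xs psi => the s [set s' | (forall v, ~ range xs v -> s' v = s v) /\ sat s' psi]
  | _ => s
  end.

Lemma skolemP (B : structure L) (s : var l -> dom B) n xs psi :
  sat s (@Ex L l n xs psi) ->
  (forall v, ~ range xs v -> skolem s (Ex xs psi) v = s v) /\
  sat (skolem s (Ex xs psi)) psi.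
Proof.
move=> [s' h1 h2].
apply: (@theP _ s [set s' | (forall v, ~ range xs v -> s' v = s v) /\ sat s' psi]).
by exists s'.
Qed.

Definition sk_gen : Type := (option H + fun_sym L + formula L l * var l)%type.

Definition sk_ar (g : sk_gen) : kappa := match g with
  | inl (inl _) => projT1 (cid (kappa_zero kappa_reg))
  | inl (inr f) => cover_dom (small_ord (fun_ar f))
  | inr p => cover_dom (small_free_vars p.1) end.

(** Besides the given elements and the functions of the language, there is for
    each formula and each variable an operation that computes the value of that
    variable in a witnessing assignment.  Its arguments are the values of the free
    variables of the formula, of which there are fewer than [kappa]. *)
Definition sk_op (g : sk_gen) : (val (sk_ar g) -> forall x, dom (A x)) -> forall x, dom (A x) :=
  match g with
  | inl (inl (Some k)) => fun=> h k
  | inl (inl None) => fun=> d0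
  | inl (inr f) => fun r x => @fun_int _ (A x) f
      (decode (d0 x) (@cover_map _ _ (small_ord (fun_ar f))) (fun k => r k x))
  | inr p => fun r x => skolem (decode (d0 x)
      (@cover_map _ _ (small_free_vars p.1)) (fun k => r k x)) p.1 p.2
  end.

Definition sk_term := wtree sk_ar.
Definition sk_eval : sk_term -> forall x, dom (A x) := wfold sk_op.

Definition sk_leaf (o : option H) : sk_term := @wnode kappa sk_gen sk_ar (inl (inl o))
  (fun i => match projT2 (cid (kappa_zero kappa_reg)) _ (eltsP i) with end).
Definition sk_app (f : fun_sym L) (ts : 'I_(fun_ar f) -> sk_term) : sk_term :=
  @wnode kappa sk_gen sk_ar (inl (inr f)) (ts \o @cover_map _ _ (small_ord (fun_ar f))).
Definition sk_witness (phi : formula L l) (s : var l -> sk_term) (v : var l) : sk_term :=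
  @wnode kappa sk_gen sk_ar (inr (phi, v)) (s \o @cover_map _ _ (small_free_vars phi)).

Definition sk_assign (s : var l -> sk_term) x (v : var l) := sk_eval (s v) x.

Lemma sk_eval_app f ts x :
  sk_eval (@sk_app f ts) x = @fun_int _ (A x) f (fun k => sk_eval (ts k) x).
Proof.
rewrite /sk_eval /=; congr fun_int; apply: funext => k.
exact: (decodeE _ (fun k => sk_eval (ts k) x) (cover_mapP (small_ord (fun_ar f)) (I : [set: _] k))).
Qed.

Definition sat_set (phi : formula L l) (s : var l -> sk_term) : set (set lambda) :=
  [set x | sat (sk_assign s x) phi].

(** The truth sets are indexed by formulas together with a short table of values
    for their free variables, since there are too many full assignments. *)
Definition sat_index : Type := (formula L l * {a : kappa & val a -> var l * sk_term})%type.

Definition sat_family (p : sat_index) : set (set lambda) := sat_set p.1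
  (decode (sk_leaf None) (fun k => (projT2 p.2 k).1) (fun k => (projT2 p.2 k).2)).

Lemma sat_setE phi s : exists p, sat_set phi s = sat_family p.
Proof.
pose e := @cover_map _ _ (small_free_vars phi).
exists (phi, existT (fun a : kappa => val a -> var l * sk_term) _ (fun k => (e k, s (e k)))).
apply/seteqP; split=> x /=; apply sat_ext => v /(cover_mapP (small_free_vars phi)) hv;
  by rewrite /sk_assign (decodeE (sk_leaf None) s hv).
Qed.

Lemma sk_witnessP s n (xs : idx n -> var l) psi x : sat (sk_assign s x) (Ex xs psi) ->
  sat (sk_assign (fun u => if `[< range xs u >] then sk_witness (Ex xs psi) s u else s u) x) psi.
Proof.
set sF := small_free_vars (Ex xs psi).
set dec := decode (d0 x) (@cover_map _ _ sF) (fun k => sk_eval (s (@cover_map _ _ sF k)) x).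
have decE v : free_vars (Ex xs psi) v -> dec v = sk_assign s x v.
  by move=> hv; exact: (decodeE (d0 x) (sk_assign s x) (cover_mapP sF hv)).
have [_ hE] := sat_ext decE.
move=> /hE/skolemP[h1 h2].
apply: (sat_ext _).1 h2 => v hv; rewrite /sk_assign; case: asboolP => // nv.
by rewrite h1 // decE.
Qed.

Fixpoint sk_subst (s : var l -> sk_term) (t : term L l) : sk_term :=
  match t with Var v => s v | App f ts => sk_app (fun k => sk_subst s (ts k)) end.

Lemma eval_sk s t x : eval (sk_assign s x) t = sk_eval (sk_subst s t) x.
Proof.
elim: t => [v|f ts IH] //=; rewrite sk_eval_app; congr fun_int.
by apply: funext => k; exact: IH.
Qed.

Lemma lam_le_sk_term : lam_le sk_term.
Proof.
apply: (lam_le_wtree kappa_reg lambda_seq); apply: lsum.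
  by apply: lsum; [exact: (lam_le_option kappa_reg)|exact: lam_le_fun_sym].
by apply: lprod; [exact: lam_le_formula|exact: sl_var sl].
Qed.

Section Quotient.

Variable U : set (set (set lambda)).
Hypothesis UF : fine_filter kappa U.
Hypothesis Udec : forall p, decides U (sat_family p).

Definition ueq (i j : sk_term) := U [set x | sk_eval i x = sk_eval j x].

Lemma ueq_refl i : ueq i i. Proof. by apply: (filt_all UF). Qed.

Lemma ueq_trans i j k : ueq i j -> ueq j k -> ueq i k.
Proof.
move=> ij jk; apply: (filt_sub UF) (filtI kappa_reg kappa_unc UF ij jk).
by move=> x [/= -> ->].
Qed.

Lemma ueq_sym i j : ueq i j -> ueq j i.
Proof. by apply: (filt_sub UF) => x /= ->. Qed.

Definition urep (i : sk_term) : sk_term := the (sk_leaf None) (ueq i).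

Lemma urepP i : ueq i (urep i).
Proof. by apply: theP; exists i; exact: ueq_refl. Qed.

Lemma urep_eq i j : ueq i j <-> urep i = urep j.
Proof.
split=> [ij|e]; last first.
  by apply: ueq_trans (urepP i) _; rewrite e; apply: ueq_sym; exact: urepP.
congr the; apply/seteqP; split=> k; apply: ueq_trans => //.
exact: ueq_sym.
Qed.

Definition ucode : sk_term -> lambda := projT1 (cid lam_le_sk_term).
Definition ucode_inj : injective ucode := projT2 (cid lam_le_sk_term).

Definition upoints : set V := range (fun i => val (ucode (urep i))).

Lemma upoints_small : is_small_class upoints.
Proof. by exists lambda, val => _ [i _ <-]; exists (ucode (urep i)). Qed.

Definition ucarrier : V := mkV upoints.

Lemma uclass_in i : val (ucode (urep i)) ∈ ucarrier.
Proof. by apply/(in_mkV _ upoints_small); exists i. Qed.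

Definition uclass (i : sk_term) : ucarrier := to_elts (uclass_in i).

Lemma uclass_surj a : exists i, uclass i = a.
Proof.
have /(in_mkV _ upoints_small)[i _ ia] := eltsP a.
by exists i; apply: val_inj.
Qed.

Lemma uclass_eq i j : uclass i = uclass j <-> ueq i j.
Proof.
rewrite urep_eq; split=> [/(f_equal val)|e]; last by apply: val_inj; rewrite /= e.
by move=> e; apply/ucode_inj/val_inj.
Qed.

Definition ulift (a : ucarrier) : sk_term := projT1 (cid (uclass_surj a)).

Lemma uliftK a : uclass (ulift a) = a.
Proof. exact: (projT2 (cid (uclass_surj a))). Qed.

Lemma uliftP i : ueq (ulift (uclass i)) i.
Proof. by apply/uclass_eq; exact: uliftK. Qed.

Lemma ulift_all n (ts : 'I_n -> sk_term) :
  U [set x | (fun k => sk_eval (ulift (uclass (ts k))) x) = (fun k => sk_eval (ts k) x)].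
Proof.
have hU : U (\bigcap_k [set x | sk_eval (ulift (uclass (ts k))) x = sk_eval (ts k) x]).
  apply: (filt_bigcap kappa_reg UF); first exact: small_ord.
  by move=> k _; exact: uliftP.
by apply: (filt_sub UF) hU => x hx; apply: funext => k; apply: hx.
Qed.

(** The domain has to be a set: classes are represented by the codes of chosen
    representatives, which form a subset of [lambda]. *)
Definition ultraproduct : structure L := @Structure L ucarrier
  (fun f args => uclass (sk_app (fun k => ulift (args k))))
  (fun r args => U [set x | @rel_int _ (A x) r (fun k => sk_eval (ulift (args k)) x)]).

Lemma eval_ultraproduct s t : eval (A := ultraproduct) (uclass \o s) t = uclass (sk_subst s t).
Proof.
elim: t => [v|f ts IH] //=; apply/uclass_eq.
apply: (filt_sub UF) (ulift_all (fun k => sk_subst s (ts k))) => x /= e.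
rewrite !sk_eval_app; congr fun_int; rewrite -e.
by apply: funext => k; rewrite IH.
Qed.

(** Decisions give negations, completeness gives conjunctions of fewer than [kappa]
    formulas, and Skolem terms give blocks of quantifiers. *)
Lemma sat_ultraproduct phi s : sat (A := ultraproduct) (uclass \o s) phi <-> U (sat_set phi s).
Proof.
elim: phi s => [t u|r ts|phi IH|n phis IH|n xs phi IH] s.
- rewrite -[sat _ _]/
      (eval (A := ultraproduct) (uclass \o s) t = eval (A := ultraproduct) (uclass \o s) u).
  rewrite !eval_ultraproduct uclass_eq /ueq /sat_set.
  by split; apply: (filt_sub UF) => x /=; rewrite !eval_sk.
- have lU := ulift_all (fun k => sk_subst s (ts k)).
  have rE x : (fun k => sk_eval (ulift (eval (A := ultraproduct) (uclass \o s) (ts k))) x) =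
      (fun k => sk_eval (ulift (uclass (sk_subst s (ts k)))) x).
    by apply: funext => k; rewrite eval_ultraproduct.
  have bE x : (fun k => eval (sk_assign s x) (ts k)) = (fun k => sk_eval (sk_subst s (ts k)) x).
    by apply: funext => k; rewrite eval_sk.
  split=> rU; apply: (filt_sub UF) (filtI kappa_reg kappa_unc UF rU lU) => x [];
    by rewrite /sat_set /= rE bE => + e; rewrite e.
- rewrite /= IH -(decidesN kappa_reg kappa_unc UF) //.
  by have [p ->] := sat_setE phi s.
- split=> /= [h1|h1 i].
    apply: (filt_sub UF (X := \bigcap_i sat_set (phis i) s)); first by move=> x hx i; apply: hx.
    by apply: (filt_bigcap kappa_reg UF) => [|i _]; [exact: sl_idx sl n|apply/IH].
  by apply/IH; apply: (filt_sub UF) h1 => x; apply.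
- split=> [[s' s's hs']|h1].
    pose t v := if `[< range xs v >] then ulift (s' v) else s v.
    have ts' : s' = uclass \o t.
      apply: funext => v; rewrite /= /t; case: asboolP => nv; last exact: s's.
      by rewrite uliftK.
    move: hs'; rewrite ts' => /IH; apply: (filt_sub UF) => x hx.
    exists (sk_assign t x) => // v nv; rewrite /sk_assign /t; by case: asboolP.
  pose t v := if `[< range xs v >] then sk_witness (Ex xs phi) s v else s v.
  exists (uclass \o t); first by move=> v nv; rewrite /= /t; case: asboolP.
  apply/IH; apply: (filt_sub UF) h1 => x; exact: sk_witnessP.
Qed.

Lemma ultraproduct_los : exists (B : structure L) (c : sk_term -> dom B),
  (forall a, exists i, c i = a) /\
  forall (phi : formula L l) (s : var l -> sk_term),
        sat (c \o s) phi <-> U [set x | sat (fun v => sk_eval (s v) x) phi].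
Proof.
exists ultraproduct, uclass; split; first exact: uclass_surj.
exact: sat_ultraproduct.
Qed.

End Quotient.

(** The terms [I] and the sets [B] do not depend on the filter, so that a filter can
    afterwards be chosen to be normal for functions defined from the terms. *)
Lemma los : exists (I : Type) (ev : I -> forall x, dom (A x))
    (JB : Type) (B : JB -> set (set lambda)),
  [/\ lam_le I, lam_le JB, forall k, exists i, ev i = h k &
    forall U, fine_filter kappa U -> (forall j, decides U (B j)) ->
    exists (M : structure L) (c : I -> dom M),
      (forall a, exists i, c i = a) /\
      forall (phi : formula L l) (s : var l -> I),
        sat (c \o s) phi <-> U [set x | sat (fun v => ev (s v) x) phi]].
Proof.
exists sk_term, sk_eval, sat_index, sat_family; split.
- exact: lam_le_sk_term.
- apply: lprod; first exact: lam_le_formula.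
  apply: (lam_le_seq lambda_seq); apply: lprod; first exact: sl_var sl.
  exact: lam_le_sk_term.
- by move=> k; exists (sk_leaf (Some k)).
- by move=> U UF Udec; exact: ultraproduct_los.
Qed.

End Formulas.

End Los.

(** * Directed unions in a club *)

Section Club.

Variable kappa : V.
Hypothesis kappa_reg : regular kappa.
Hypothesis kappa_unc : ~ countable kappa.

Notation small := (small kappa).

Variables (T : Type) (X : set T) (C : set (set T)).
Hypothesis CC : club kappa X C.

(** The unions of the initial segments of an enumeration are members of [C], by
    induction.  A new member of the chain that does not contain all the earlier
    ones is contained in one of them, and adds nothing to the union of the earlier
    unions; otherwise it is the new union. *)
Lemma club_chain (K : set (set T)) : small K -> K !=set0 -> K `<=` C ->
  (forall y z, K y -> K z -> y `<=` z \/ z `<=` y) -> C (\bigcup_(y in K) y).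
Proof.
move=> /(small_exact kappa_reg)[a [e Ke]] K0 KC Kc.
have [_ _ Cinc] := CC.
pose r (i : val a) := \bigcup_(k in [set k : val a | val k ∈ val i \/ k = i]) e k.
have oa := kappa_elem_ord kappa_reg a.
have oi (i : val a) : is_ordinal (val i) := ord_elem oa (eltsP i).
have rsub i j : val i ∈ val j -> r i `<=` r j.
  move=> ij t [k [ki|->] ekt]; [exists k => //|exists i => //]; left => //.
  exact: ord_trans ij ki.
have rC i : C (r i).
  case: i => v vv; elim/(well_founded_ind elem_wf): v vv => v IH vv.
  set i : val a := exist _ v vv.
  have [H|H] := pselect (forall k : val a, val k ∈ val i -> e k `<=` e i).
    suff -> : r i = e i by apply: KC; rewrite Ke; exists i.
    apply/seteqP; split=> t; last by exists i => //; right.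
    by move=> [k [ki|->] //]; apply: H.
  have [k0 k0i nk0] : exists2 k : val a, val k ∈ val i & ~ e k `<=` e i.
    apply: contrapT => H'; apply: H => k ki; apply: contrapT => nk.
    by apply: H'; exists k.
  have ik0 : e i `<=` e k0.
    by case: (Kc (e k0) (e i)) => //; rewrite Ke; [exists k0|exists i].
  pose emb (k : v) : val a := to_elts (ord_trans oa (eltsP i) (eltsP k)).
  have := Cinc v (r \o emb); rewrite (_ : \bigcup_k (r \o emb) k = r i).
    apply.
    - exact: kappa_elem_sub kappa_reg _ _ (eltsP i).
    - by exists (val k0).
    - by move=> k; apply: IH; exact: eltsP.
    - by move=> k k'; exact: (@rsub (emb k) (emb k')).
  apply/seteqP; split=> t.
    by move=> [k _]; apply: (@rsub (emb k) i); exact: eltsP.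
  have k0P k (ki : val k ∈ val i) : emb (to_elts ki) = k by apply: val_inj.
  move=> [k [ki|->] ekt].
    by exists (to_elts ki) => //=; exists k => //; right; rewrite k0P.
  by exists (to_elts k0i) => //=; exists k0; [right; rewrite k0P|apply: ik0].
suff -> : \bigcup_(y in K) y = \bigcup_i r i.
  apply: Cinc => //; first exact: eltsP.
  by case: K0 => y; rewrite Ke => -[i _ _]; exists (val i); exact: eltsP.
apply/seteqP; split=> t.
  by rewrite Ke => -[y [i _ <-] eit]; exists i => //; exists i => //; right.
by move=> [i _ [k _ ekt]]; exists (e k) => //; rewrite Ke; exists k.
Qed.

Section Directed.

Variables (D : set (set T)) (dir : set T -> set T -> set T).
Hypothesis DC : D `<=` C.
Hypothesis dirD : forall y z, D y -> D z -> D (dir y z).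
Hypothesis dirl : forall y z, D y -> D z -> y `<=` dir y z.
Hypothesis dirr : forall y z, D y -> D z -> z `<=` dir y z.

Inductive dir_closure (G : set (set T)) : set T -> Prop :=
| DirIn y of G y : dir_closure G y
| DirDir y z of dir_closure G y & dir_closure G z : dir_closure G (dir y z).

Lemma dir_closure_sub G : G `<=` D -> dir_closure G `<=` D.
Proof. by move=> GD y; elim=> {y} [y /GD|y z _ yD _ zD] //; exact: dirD. Qed.

Lemma dir_closure_mono G G' : G `<=` G' -> dir_closure G `<=` dir_closure G'.
Proof.
by move=> GG y; elim=> {y} [y /GG|y z _ yG _ zG]; [exact: DirIn|exact: DirDir].
Qed.

Lemma dir_closure_countable G : countable G -> countable (dir_closure G).
Proof.
move=> cG.
pose lev := fix lev n := if n is n.+1 then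
  lev n `|` (fun p => dir p.1 p.2) @` (lev n `*` lev n) else G.
have clev n : countable (lev n).
  elim: n => [//|n IH] /=; rewrite -bigcup2E; apply: bigcup_countable => // i _.
  case: i => [//|[|i]] //=.
  apply: sub_countable (card_image_le _ _) _; exact: countableX.
have levS m n : m <= n -> lev m `<=` lev n.
  move=> /subnK <-; elim: (n - m) => [//|k IH] y /IH h; by left.
apply: (@sub_countable _ _ _ (\bigcup_n lev n)); last exact: bigcup_countable.
apply: subset_card_le => y; elim=> {y} [y Gy|y z _ [m _ my] _ [n _ nz]].
  by exists 0.
exists (maxn m n).+1 => //; right; exists (y, z) => //; split.
  exact: levS (leq_maxl m n) _ my.
exact: levS (leq_maxr m n) _ nz.
Qed.

(** A countable directed family has the same union as an increasing sequence in it. *)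
Lemma dir_closure_club_countable G : countable G -> G !=set0 -> G `<=` D ->
  C (\bigcup_(y in dir_closure G) y).
Proof.
move=> cG [y0 Gy0] GD; have GDc := dir_closure_sub GD.
have /countable_injP[f fI] := dir_closure_countable cG.
have Cy0 : dir_closure G y0 := DirIn Gy0.
pose d n := if pselect (exists2 y, dir_closure G y & f y = n) is left ex
  then projT1 (cid2 ex) else y0.
have dP n : dir_closure G (d n).
  by rewrite /d; case: pselect => // ex; case: cid2.
have dsurj y : dir_closure G y -> exists n, d n = y.
  move=> Gy; exists (f y); rewrite /d; case: pselect => [ex|]; last by case; exists y.
  by case: cid2 => z Gz /= fzy; apply: fI => //; apply/mem_set.
pose s := fix s n := if n is n.+1 then dir (s n) (d n) else y0.
have sP n : dir_closure G (s n) by elim: n => [//|n IH]; exact: DirDir.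
have sS m n : m <= n -> s m `<=` s n.
  move=> /subnK <-; elim: (n - m) => [//|k IH] t /IH; apply: dirl; exact: GDc.
have -> : \bigcup_(y in dir_closure G) y = \bigcup_(y in range s) y.
  apply/seteqP; split=> t; last by move=> [_ [n _ <-] snt]; exists (s n).
  move=> [y /dsurj[n <-] dnt]; exists (s n.+1); first by exists n.+1.
  by apply: dirr dnt; exact: GDc.
apply: club_chain.
- apply: small_countable => //; apply: sub_countable (card_image_le _ _) _; exact: countableP.
- by exists (s 0), 0.
- by move=> _ [n _ <-]; apply/DC/GDc.
- move=> _ _ [m _ <-] [n _ <-]; case: (leqP m n) => [|/ltnW] h; [left|right];
    exact: sS.
Qed.

(** The generators are added one by one along an ordinal; successor steps are
    absorbed by the countable set [K], and limit steps are unions of chains. *)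
Lemma dir_closure_club (g : V -> set T) (a : kappa) (i : V) (K : set (set T)) :
  (forall k, k ∈ val a -> D (g k)) ->
  is_ordinal i -> i `<=` val a -> countable K -> K !=set0 -> K `<=` D ->
  C (\bigcup_(y in dir_closure (K `|` g @` i)) y).
Proof.
move=> gD; elim/(well_founded_ind elem_wf): i K => i IH K oi ia cK K0 KD.
have giD j : j `<=` val a -> K `|` g @` j `<=` D.
  by move=> ja y [/KD//|[k /ja/gD h <-]].
have [[k0 k0i]|nk] := pselect (exists k, k ∈ i); last first.
  rewrite (_ : g @` i = set0) ?setU0; first exact: dir_closure_club_countable.
  by apply/seteqP; split=> // y [k ki]; case: nk; exists k.
have subi m : m ∈ i -> m `<=` i by case: oi => ti _ /ti.
have [[m mi mmax]|nmax] := pselect (exists2 m, m ∈ i & forall k, k ∈ i -> k ∈ m \/ k = m).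
  rewrite (_ : K `|` g @` i = (K `|` [set g m]) `|` g @` m).
    apply: IH => //.
    - exact: ord_elem mi.
    - by apply: subset_trans ia; exact: subi.
    - by rewrite -bigcup2E; apply: bigcup_countable => // -[|[|j]] _ /=.
    - by case: K0 => y Ky; exists y; left.
    - by move=> y [/KD//|->]; apply/gD/ia.
  apply/seteqP; split=> y.
    move=> [Ky|[k /mmax[km|->] <-]]; [by left; left|by right; exists k|by left; right].
  move=> [[Ky|->]|[k km <-]]; [by left|by right; exists m|right; exists k => //].
  exact: subi km.
have lim m : m ∈ i -> exists2 k, k ∈ i & m ∈ k.
  move=> mi; apply: contrapT => H; apply: nmax; exists m => // k ki.
  have [h|h|h] := ord_trichotomy (ord_elem oi ki) (ord_elem oi mi); [by left|by right|].
  by case: H; exists k.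
pose S m := dir_closure (K `|` g @` m).
have Smono m n : m ∈ n -> n ∈ i -> S m `<=` S n.
  move=> mn ni; apply: dir_closure_mono => y [Ky|[k km <-]]; first by left.
  by right; exists k => //; apply: ord_trans (ord_elem oi ni) mn km.
have -> : \bigcup_(y in S i) y = \bigcup_(y in (fun m => \bigcup_(y in S m) y) @` i) y.
  apply/seteqP; split=> t.
    move=> [y Sy yt].
    suff [m mi Smy] : exists2 m, m ∈ i & S m y.
      by exists (\bigcup_(y in S m) y); [exists m|exists y].
    elim: Sy => {y yt} [y [Ky|[k ki <-]]|y z _ [m mi my] _ [n ni nz]].
    - by exists k0 => //; apply: DirIn; left.
    - by have [m mi km] := lim k ki; exists m => //; apply: DirIn; right; exists k.
    - have [mn|mn|nm] := ord_trichotomy (ord_elem oi mi) (ord_elem oi ni).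
      + by exists n => //; apply: DirDir => //; exact: Smono my.
      + by exists n => //; apply: DirDir => //; rewrite -mn.
      + by exists m => //; apply: DirDir => //; exact: Smono nz.
  move=> [_ [m mi <-] [y Smy yt]]; exists y => //.
  apply: dir_closure_mono Smy => z [Kz|[k km <-]]; [by left|right; exists k => //].
  exact: subi km.
apply: club_chain.
- apply: small_image; apply: small_sub (small_elem a); exact: ia.
- by exists (\bigcup_(y in S k0) y), k0.
- move=> _ [m mi <-]; apply: IH => //; first exact: ord_elem mi.
  by apply: subset_trans ia; exact: subi.
- move=> _ _ [m mi <-] [n ni <-].
  have [mn|->|nm] := ord_trichotomy (ord_elem oi mi) (ord_elem oi ni).
  + by left=> t [y Sy yt]; exists y => //; exact: Smono Sy.
  + by left.
  + by right=> t [y Sy yt]; exists y => //; exact: Smono Sy.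
Qed.

End Directed.

(** The family is the closure of itself under a choice of upper bounds. *)
Lemma club_directed (D : set (set T)) : small D -> D !=set0 -> D `<=` C ->
  (forall y z, D y -> D z -> exists2 w, D w & y `|` z `<=` w) ->
  C (\bigcup_(y in D) y).
Proof.
move=> /(small_exact kappa_reg)[a [e De]] [y0 Dy0] DC Ddir.
pose dir y z := the y0 [set w | D w /\ y `|` z `<=` w].
have dirP y z : D y -> D z -> D (dir y z) /\ y `|` z `<=` dir y z.
  move=> Dy Dz; apply: (@theP _ y0 [set w | D w /\ y `|` z `<=` w]).
  by have [w Dw h] := Ddir y z Dy Dz; exists w.
pose g v := if pselect (v ∈ val a) is left va then e (to_elts va) else y0.
have gD v : v ∈ val a -> D (g v).
  by move=> va; rewrite /g De; case: pselect => // va'; exists (to_elts va').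
have dD y z : D y -> D z -> D (dir y z) by move=> Dy Dz; case: (dirP y z Dy Dz).
have := @dir_closure_club D dir DC dD _ _ g a (val a) [set y0] gD.
have -> : \bigcup_(y in dir_closure dir ([set y0] `|` g @` val a)) y = \bigcup_(y in D) y.
  apply/seteqP; split=> t [y yP yt]; exists y => //.
    by apply: dir_closure_sub yP => // z [->//|[k /gD h <-]].
  apply: DirIn; right; move: yP; rewrite De => -[k _ <-].
  exists (val k); first exact: eltsP.
  rewrite /g; case: pselect => [h|]; last by case; exact: eltsP.
  by congr e; apply: val_inj.
apply=> //.
- by move=> y z Dy Dz t yt; apply: (dirP y z Dy Dz).2; left.
- by move=> y z Dy Dz t yt; apply: (dirP y z Dy Dz).2; right.
- exact: kappa_elem_ord.
- by exists y0.
- by move=> _ ->.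
Qed.

End Club.

(** * Type omission from normal filters *)

Section Compactness.

Variables kappa lambda : V.
Hypothesis kappa_reg : regular kappa.
Hypothesis kappa_unc : ~ countable kappa.
Hypothesis kappa_lambda : kappa `<=` lambda.
Hypothesis lambda_seq : [set: lt_seq kappa lambda] #= lambda.
Hypothesis nf : normal_filters kappa lambda.

Notation small := (small kappa).
Notation lam_le := (lam_le lambda).
Notation idx_set := (@idx_set kappa lambda).

(** Clubs are measure one.  By normality, almost every [x] is such that every
    element of its trace is in a member of [C] coded in [x] (R1), that the members
    of [C] coded in [x] are included in its trace (R2), and that two of them are
    included in a third (R3).  The trace is then the union of a small directed
    subfamily of [C]. *)
Lemma normal_club (T : Type) (X : set T) (C : set (set T)) (h : T -> lambda)
    (kc : set T -> lambda) : injective h ->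
  (forall y z, small y -> small z -> kc y = kc z -> y = z) ->
  club kappa X C ->
  exists2 R : lambda + (bool + unit) -> lambda -> set (set lambda), True &
  forall U, fine_filter kappa U ->
    (forall j, (forall c, U (R j c)) -> U [set x | forall c, x c -> R j c x]) ->
    U [set x | C [set t | X t /\ x (h t)]].
Proof.
move=> hI kcI CC; have [CP Ccof _] := CC.
have Csm y : C y -> small y by move=> /CP[_ /(small_card_lt kappa_reg)].
have [y0 Cy0 _] : exists2 y, C y & set0 `<=` y.
  by apply: Ccof; split=> //; apply/small_card_lt => //; exact: small0.
pose tr (x : set lambda) := [set t | X t /\ x (h t)].
pose R1 c : set (set lambda) := [set x | forall t, X t -> h t = c ->
  exists y, [/\ C y, y t & x (kc y)]].
pose R2 c : set (set lambda) := [set x | forall y, C y -> kc y = c -> y `<=` tr x].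
pose R3 c c' : set (set lambda) := [set x | forall y z, C y -> C z -> kc y = c ->
  kc z = c' -> exists w, [/\ C w, y `|` z `<=` w & x (kc w)]].
exists (fun j => match j with
  | inl c => R3 c | inr (inl true) => R1 | inr (inl false) => R2
  | inr (inr tt) => fun c => [set x | forall c', x c' -> R3 c c' x] end) => //.
move=> U UF UR.
have UT : U [set x | True] by apply: (filt_all UF).
have U1 : U [set x | forall c, x c -> R1 c x].
  apply: (UR (inr (inl true))) => c.
  have [[t [Xt ht]]|nt] := pselect (exists t, X t /\ h t = c); last first.
    by apply: (filt_sub UF) UT => x _ t Xt ht; case: nt; exists t.
  have [|y Cy ty] := Ccof [set t].
    split; first by move=> _ ->.
    by apply/small_card_lt => //; exact: small1.
  apply: (filt_sub UF) (filt_mem UF (kc y)) => x xy t' Xt' ht'.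
  have -> : t' = t by apply: hI; rewrite ht'.
  by exists y; split=> //; apply: ty.
have U2 : U [set x | forall c, x c -> R2 c x].
  apply: (UR (inr (inl false))) => c.
  have [[y [Cy yc]]|ny] := pselect (exists y, C y /\ kc y = c); last first.
    by apply: (filt_sub UF) UT => x _ y Cy yc; case: ny; exists y.
  apply: (@filt_sub _ _ U UF (\bigcap_(t in y) [set x | x (h t)])).
    move=> x xy y' Cy' y'c t y't.
    have e : y' = y by apply: kcI; rewrite ?yc //; exact: Csm.
    by split; [apply: (CP _ Cy').1|apply: xy; rewrite -e].
  apply: (filt_bigcap kappa_reg UF); first exact: Csm.
  by move=> t _; exact: filt_mem UF (h t).
have U3 : U [set x | forall c, x c -> forall c', x c' -> R3 c c' x].
  apply: (UR (inr (inr tt))) => c; apply: (UR (inl c)) => c'.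
  have [[y [z [Cy Cz yc zc]]]|nyz] := pselect (exists y z,
      [/\ C y, C z, kc y = c & kc z = c']); last first.
    by apply: (filt_sub UF) UT => x _ y z Cy Cz yc zc; case: nyz; exists y, z.
  have [|w Cw yzw] := Ccof (y `|` z).
    split; first by move=> t [/(CP _ Cy).1|/(CP _ Cz).1].
    by apply/small_card_lt => //; apply: smallU => //; exact: Csm.
  apply: (filt_sub UF) (filt_mem UF (kc w)) => x xw y' z' Cy' Cz' y'c z'c.
  have -> : y' = y by apply: kcI; rewrite ?yc //; exact: Csm.
  have -> : z' = z by apply: kcI; rewrite ?zc //; exact: Csm.
  by exists w.
have UI := filtI kappa_reg kappa_unc UF.
apply: (filt_sub UF) (UI _ _ (UI _ _ (UI _ _ U1 U2) U3)
  (UI _ _ (filt_idx UF) (filt_mem UF (kc y0)))).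
move=> x [[[x1 x2] x3] [[sx _] xy0]].
pose D := [set y | C y /\ x (kc y)].
suff : C (tr x) by [].
rewrite (_ : tr x = \bigcup_(y in D) y).
  apply: (club_directed kappa_reg kappa_unc CC).
  - apply: small_sub (small_image (fun c => the y0 [set y | C y /\ kc y = c]) sx).
    move=> y [Cy xy]; exists (kc y) => //.
    have [Ct et] : [set y' | C y' /\ kc y' = kc y] (the y0 [set y' | C y' /\ kc y' = kc y]).
      by apply: theP; exists y.
    by apply: kcI => //; exact: Csm.
  - by exists y0.
  - by move=> y [].
  - move=> y z [Cy xy] [Cz xz].
    have [w [Cw yzw xw]] := x3 _ xy _ xz _ _ Cy Cz erefl erefl.
    by exists w.
apply/seteqP; split=> t.
  move=> [Xt xt]; have [y [Cy yt xy]] := x1 _ xt _ Xt erefl.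
  by exists y.
by move=> [y [Cy xy] yt]; exact: (x2 _ xy _ Cy erefl _ yt).
Qed.

(** The structure at [x] is a model for the trace of [x] on [T `|` p].  The value
    at [x] of an element of the product does not realize the trace of the type, and
    the choice of a formula that it fails to satisfy is a regressive function. *)
Lemma normal_compact (l : logic) : small_logic kappa lambda l ->
  compact_type_omission kappa l lambda.
Proof.
move=> sl L T v0 p Lsize Tth pty [C CC CA].
have lL : lam_le (fun_sym L + rel_sym L).
  have [/card_leE[c cI] _] := (card_eqPle _ _).1 Lsize.
  by exists (c \o to_setT) => x y /= /cI/(f_equal val).
have [h hI] := lam_le_formula kappa_reg kappa_unc kappa_lambda lambda_seq sl lL.
have [kc kcI] := lam_le_small_set kappa_reg kappa_lambda lambda_seq
  (lam_le_formula kappa_reg kappa_unc kappa_lambda lambda_seq sl lL).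
have [a0 _] := lambda_inh kappa_reg kappa_lambda.
have [_ Ccof _] := CC.
have [y0 Cy0 _] : exists2 y, C y & set0 `<=` y.
  by apply: Ccof; split=> //; apply/small_card_lt => //; exact: small0.
have mod y : exists A : structure L, C y -> models A (y `&` T) /\ omits A (y `&` p).
  have [Cy|nCy] := pselect (C y); last first.
    by have [A _ _] := CA _ Cy0; exists A.
  by have [A AT Ap] := CA _ Cy; exists A.
have [Am AmP] := choice mod.
pose tr x := [set phi | (T `|` p) phi /\ x (h phi)].
pose A x := Am (if `[< C (tr x) >] then tr x else y0).
have AP x : C (tr x) -> models (A x) (tr x `&` T) /\ omits (A x) (tr x `&` p).
  by move=> Cx; rewrite /A asboolT //; exact: AmP.
have Ad x : exists a : dom (A x), True.
  have [d dA] : dom (A x) !=set0.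
    by rewrite /A; case: asboolP => [/AmP|_]; [|have := AmP _ Cy0] => -[[]].
  by exists (to_elts dA).
pose d0 x := projT1 (cid (Ad x)).
have [I [ev [JB [B [lI lB hI' los]]]]] := los kappa_reg kappa_unc kappa_lambda
  lambda_seq sl lL d0 (fun=> d0) (lam_le_unit kappa_reg kappa_lambda).
have [R _ RP] := normal_club hI kcI CC.
pose f i x := the a0 [set c | exists phi, [/\ tr x phi, p phi, c = h phi &
  ~ sat (fun=> ev i x) phi]].
have lR : lam_le (lambda + (bool + unit)).
  have lsum := lam_le_sum kappa_reg kappa_lambda lambda_seq.
  apply: (lsum); first exact: lam_le_lam.
  by apply: (lsum);
    [exact: (lam_le_bool kappa_reg kappa_lambda)|exact: (lam_le_unit kappa_reg kappa_lambda)].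
have [U [UF UB Uf UR]] := normal_filters_diag kappa_reg kappa_unc kappa_lambda
  lambda_seq nf lB lI lR B f R.
have UI := filtI kappa_reg kappa_unc UF.
have UC : U [set x | C (tr x)] by apply: RP.
have [M [c [cS los']]] := los U UF UB.
have [i0 _] := hI' tt.
exists M.
  split; first by exists (val (c i0)); exact: eltsP.
  move=> phi Tphi s; have [s' s'P] := choice (fun v => cS (s v)).
  have -> : s = c \o s' by apply: funext => v; rewrite /= s'P.
  apply/los'; apply: (filt_sub UF) (UI _ _ UC (filt_mem UF (h phi))).
  move=> x [/= /AP[[_ AT] _] xphi]; apply: AT; split=> //; split=> //; by left.
move=> a Ha; have [i ia] := cS a.
have Hp phi : p phi -> U [set x | sat (fun=> ev i x) phi].
  by move=> pphi; apply: (los' phi (fun=> i)).1; rewrite /comp ia; exact: Ha.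
have fP x : C (tr x) -> exists phi, [/\ tr x phi, p phi, f i x = h phi &
    ~ sat (fun=> ev i x) phi].
  move=> /AP[_ Ao].
  apply: (@theP _ a0 [set c | exists phi, [/\ tr x phi, p phi, c = h phi &
    ~ sat (fun=> ev i x) phi]]).
  apply: contrapT => H; apply: (Ao (ev i x)) => phi [xphi pphi].
  by apply: contrapT => ns; apply: H; exists (h phi), phi.
have [|b Ub] := Uf i.
  by apply: (filt_sub UF) UC => x /fP[phi [[_ xphi] _ e _]] /=; rewrite e.
have [x _ [/fP[phi [_ pphi e _]] fb]] := filt_ex kappa_reg kappa_unc UF (UI _ _ UC Ub).
have [x' _ [[/fP[phi' [_ _ e' ns]] fb'] sx']] :=
  filt_ex kappa_reg kappa_unc UF (UI _ _ (UI _ _ UC Ub) (Hp phi pphi)).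
apply: ns; rewrite (_ : phi' = phi) //; apply: hI.
by rewrite -e -e' -[RHS]/(f i x); move: fb fb' => /= -> ->.
Qed.

End Compactness.

(** * The two logics and the language of sets *)

Section SmallLogics.

Variables kappa lambda : V.
Hypothesis kappa_reg : regular kappa.
Hypothesis kappa_unc : ~ countable kappa.
Hypothesis kappa_lambda : kappa `<=` lambda.
Hypothesis lambda_seq : [set: lt_seq kappa lambda] #= lambda.

Lemma small_logic_Lww : small_logic kappa lambda Lww.
Proof.
split.
- exact: (lam_le_nat kappa_reg kappa_lambda).
- exact: (lam_le_nat kappa_reg kappa_lambda).
- by move=> n; exact/(small_finite kappa_reg kappa_unc)/finite_finset.
- by exists 2, ord0, ord_max.
- by exists 0.
Qed.

Lemma small_logic_Lkk : small_logic kappa lambda (Lkk kappa).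
Proof.
split.
- exact: (lam_le_kappa kappa_lambda).
- exact: (lam_le_kappa kappa_lambda).
- by move=> n; exact: small_elem_type.
- exact: kappa_two.
- by have [a _] := kappa_zero kappa_reg; exists a.
Qed.

End SmallLogics.

(** A syntax whose meaning is computed by simplification, which [formula] does not
    allow because its conjunctions and blocks of quantifiers are families. *)
Inductive fm :=
| FIn of nat & nat | FEq of nat & nat | FAnd of fm & fm | FOr of fm & fm
| FImp of fm & fm | FAll of nat & fm | FEx of nat & fm.

Definition upd T (s : nat -> T) n a : nat -> T :=
  fun m => if m == n then a else s m.

Definition mem_in (A : structure Lin) (a b : dom A) : Prop :=
  @rel_int Lin A tt (fun k : 'I_2 => if k == ord0 then a else b).

Fixpoint den (A : structure Lin) (s : nat -> dom A) (f : fm) : Prop :=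
  match f with
  | FIn m n => mem_in (s m) (s n)
  | FEq m n => s m = s n
  | FAnd f g => den s f /\ den s g
  | FOr f g => den s f \/ den s g
  | FImp f g => den s f -> den s g
  | FAll n f => forall a, den (upd s n a) f
  | FEx n f => exists a, den (upd s n a) f
  end.

Definition and2 (phi psi : formula Lin Lww) : formula Lin Lww :=
  @And Lin Lww 2 (fun i : 'I_2 => if i == ord0 then phi else psi).

Definition ex1 (n : nat) (phi : formula Lin Lww) : formula Lin Lww :=
  @Ex Lin Lww 1 (fun=> n) phi.

Fixpoint to_formula (f : fm) : formula Lin Lww :=
  match f with
  | FIn m n => @Rel Lin Lww tt
      (fun k : 'I_2 => if k == ord0 then Var Lin (l := Lww) m else Var Lin (l := Lww) n)
  | FEq m n => Eq (Var Lin (l := Lww) m) (Var Lin (l := Lww) n)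
  | FAnd f g => and2 (to_formula f) (to_formula g)
  | FOr f g => Neg (and2 (Neg (to_formula f)) (Neg (to_formula g)))
  | FImp f g => Neg (and2 (to_formula f) (Neg (to_formula g)))
  | FAll n f => Neg (ex1 n (Neg (to_formula f)))
  | FEx n f => ex1 n (to_formula f)
  end.

Lemma sat_and2 (A : structure Lin) (s : nat -> dom A) phi psi :
  sat (l := Lww) s (and2 phi psi) <-> sat (l := Lww) s phi /\ sat (l := Lww) s psi.
Proof.
split=> /= [h|[h1 h2] i]; last by case: ifP.
by split; [apply: (h ord0)|apply: (h ord_max)].
Qed.

Lemma sat_ex1 (A : structure Lin) (s : nat -> dom A) n phi :
  sat (l := Lww) s (ex1 n phi) <-> exists a, sat (l := Lww) (upd s n a) phi.
Proof.
split=> /= [[s' h1 h2]|[a h]].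
  exists (s' n); rewrite (_ : upd s n (s' n) = s') //.
  apply: funext => m; rewrite /upd; case: eqP => [->//|ne].
  by rewrite h1 // => -[_ _ e]; apply: ne.
exists (upd s n a) => // v nv; rewrite /upd; case: eqP => // e; subst v.
by case: nv; exists ord0.
Qed.

Lemma sat_den (A : structure Lin) (s : nat -> dom A) f :
  sat (l := Lww) s (to_formula f) <-> den s f.
Proof.
elim: f s => [m n|m n|f IHf g IHg|f IHf g IHg|f IHf g IHg|n f IH|n f IH] s.
- rewrite /= /mem_in; suff -> : (fun i : 'I_2 => eval (l := Lww) s
      (if i == ord0 then Var Lin (l := Lww) m else Var Lin (l := Lww) n)) =
    (fun k : 'I_2 => if k == ord0 then s m else s n) by [].
  by apply: funext => k; case: ifP.
- by [].
- by rewrite sat_and2 IHf IHg.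
- rewrite -[sat _ _]/(~ sat (A := A) (l := Lww) s (and2 _ _)) sat_and2 /= -IHf -IHg.
  split=> [h|[fs [nf _]|gs [_ ng]]//].
  by apply: contrapT => nfg; apply: h; split=> ?; apply: nfg; [left|right].
- rewrite -[sat _ _]/(~ sat (A := A) (l := Lww) s (and2 _ _)) sat_and2 /= -IHf -IHg.
  split=> [h fs|h [fs]]; last by apply; exact: h.
  by apply: contrapT => ng; apply: h.
- rewrite -[sat _ _]/(~ sat (A := A) (l := Lww) s (ex1 n (Neg (to_formula f)))) sat_ex1 /=.
  split=> [h a|h [a]]; last by apply; apply/IH; exact: h.
  by apply/IH; apply: contrapT => na; apply: h; exists a.
- rewrite sat_ex1 /=; split=> -[a h]; exists a; exact/IH.
Qed.

Lemma mem_inE (M : V) (a b : M) : mem_in (A := in_structure M) a b = (val a ∈ val b).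
Proof. by []. Qed.

Lemma iso_sat (A B : structure Lin) (F : dom A -> dom B) :
  injective F -> (forall b, exists a, F a = b) ->
  (forall a a', mem_in a a' <-> mem_in (F a) (F a')) ->
  forall (phi : formula Lin Lww) (s : nat -> dom A),
    sat (l := Lww) s phi <-> sat (l := Lww) (F \o s) phi.
Proof.
move=> FI FS FE.
have ev t (s : nat -> dom A) : eval (l := Lww) (F \o s) t = F (eval (l := Lww) s t).
  by case: t => [//|[]].
elim=> [t u|[] ts|phi IH|n phis IH|n xs phi IH] s /=.
- by rewrite !ev; split=> [->|/FI].
- have argE (C : structure Lin) (a : 'I_2 -> dom C) :
      @rel_int Lin C tt a <-> mem_in (a ord0) (a ord_max).
    rewrite /mem_in (_ : (fun k => _) = a) //; apply: funext => k.
    by case: ifP => [/eqP ->//|nk]; congr a; apply: val_inj; case: k nk => -[|[]].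
  by rewrite !argE FE !ev.
- by rewrite IH.
- by split=> h i; apply/IH.
- split=> [[s' h1 h2]|[s' h1 h2]].
    exists (F \o s'); last exact/IH.
    by move=> v nv; rewrite /= h1.
  have [g gF] := choice FS.
  have s'E : s' = F \o (g \o s') by apply: funext => v; rewrite /= gF.
  exists (g \o s'); last by apply/IH; rewrite -s'E.
  by move=> v nv; apply: FI; rewrite -[LHS]/((F \o (g \o s')) v) -s'E h1.
Qed.

(** * Embeddings from normal filters *)

Section Collapse.

Variables (D : V) (R : D -> D -> Prop).
Hypothesis R_wf : well_founded R.
Hypothesis R_ext : forall a b, (forall c, R c a <-> R c b) -> a = b.

(** The Mostowski collapse. *)
Definition collapse : D -> V := Fix R_wf (fun=> V)
  (fun a rec => mkV [set y | exists b (h : R b a), y = rec b h]).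

Lemma collapseE a y : y ∈ collapse a <-> exists2 b, R b a & y = collapse b.
Proof.
rewrite /collapse Fix_eq.
  rewrite in_mkV; first by split=> [[b [h ->]]|[b h ->]]; exists b.
  exists D, collapse => z [b [h ->]]; by exists b.
move=> b f g fg; congr mkV; apply/seteqP.
by split=> z [c [h ->]]; exists c, h; rewrite fg.
Qed.

Lemma collapse_inj : injective collapse.
Proof.
move=> a; elim/(well_founded_ind R_wf): a => a IH b e.
apply: R_ext => c; split=> h.
  have /collapseE[c' h' /(IH c h) ->//] : collapse c ∈ collapse b.
  by rewrite -e; apply/collapseE; exists c.
have /collapseE[c' h' e'] : collapse c ∈ collapse a.
  by rewrite e; apply/collapseE; exists c.
by rewrite -(IH c' h' c).
Qed.

Lemma collapse_elem a b : R a b <-> collapse a ∈ collapse b.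
Proof.
split=> [h|/collapseE[c h /collapse_inj ->//]].
by apply/collapseE; exists a.
Qed.

Definition collapse_set : V := mkV (range collapse).

Lemma in_collapse_set y : y ∈ collapse_set <-> exists a, y = collapse a.
Proof.
rewrite in_mkV; last by exists D, collapse.
by split=> [[a _ <-]|[a ->]]; exists a.
Qed.

Lemma collapse_set_trans : transitive_set collapse_set.
Proof.
move=> y /in_collapse_set[a ->] z /collapseE[b _ ->].
by apply/in_collapse_set; exists b.
Qed.

End Collapse.

Definition ord_fm : fm :=
  FAnd (FAll 1 (FImp (FIn 1 0) (FAll 2 (FImp (FIn 2 1) (FIn 2 0)))))
    (FAll 1 (FImp (FIn 1 0) (FAll 2 (FImp (FIn 2 1)
      (FAll 3 (FImp (FIn 3 2) (FIn 3 1))))))).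

Lemma den_ord (M : V) (s : nat -> M) : transitive_set M ->
  den (A := in_structure M) s ord_fm <-> is_ordinal (val (s 0)).
Proof.
move=> tM.
have MT (b : M) y : y ∈ val b -> y ∈ M by move=> yb; apply: (tM _ (eltsP b)).
rewrite /= /upd /=; split=> [[h1 h2]|[h1 h2]].
  split=> [b b0 c cb|b b0 c cb d dc].
    have bM := MT _ _ b0; have cM := MT (to_elts bM) _ cb.
    exact: (h1 (to_elts bM) b0 (to_elts cM) cb).
  have bM := MT _ _ b0; have cM := MT (to_elts bM) _ cb.
  have dM := MT (to_elts cM) _ dc.
  exact: (h2 (to_elts bM) b0 (to_elts cM) cb (to_elts dM) dc).
split=> [b b0 c cb|b b0 c cb d dc]; first exact: (h1 _ b0 _ cb).
exact: (h2 _ b0 _ cb _ dc).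
Qed.

Section Embedding.

Variables kappa lambda : V.
Hypothesis kappa_reg : regular kappa.
Hypothesis kappa_unc : ~ countable kappa.
Hypothesis lambda_card : is_cardinal lambda.
Hypothesis kappa_lambda : kappa `<=` lambda.
Hypothesis lambda_seq : [set: lt_seq kappa lambda] #= lambda.
Hypothesis nf : normal_filters kappa lambda.

Notation small := (small kappa).
Notation lam_le := (lam_le lambda).
Notation idx_set := (@idx_set kappa lambda).

Variable M : V.
Hypothesis M_trans : transitive_set M.
Hypothesis M_card : M #= lambda.
Hypothesis kappa_M : kappa ∈ M.
Hypothesis M_closed : seq_closed kappa M.

Lemma M_range (S : set M) : small S -> exists r : M, val r = val @` S :> set V.
Proof.
move=> /(small_exact kappa_reg)[a [e Se]].
have [_ [r rM rE]] := M_closed (existT (fun a : kappa => val a -> M) a e).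
exists (to_elts rM); rewrite -[LHS]/(elts r) rE Se; apply/seteqP; split=> y.
  by move=> [i _ <-]; exists (e i) => //; exists i.
by move=> [_ [i _ <-] <-]; exists i.
Qed.

(** In the product of copies of [M], the function [d] sends [x] to the set of the
    elements of [M] coded in [x]; by normality its elements in the quotient are
    exactly the constants.  The functions [oe] choose an ordinal below [kappa] and
    an injection of [x] into it; their classes are an ordinal below j(kappa) and an
    injection of [lambda] into it, so that j(kappa) exceeds the cardinal [lambda]. *)
Lemma normal_embedding : exists (N : V) (j : M -> N),
  [/\ transitive_set N, elementary j,
    exists k : M, [/\ val k = kappa, is_crit j k & lambda ∈ val (j k)] &
    exists2 y, y ∈ N & y = range (val \o j) :> set V].
Proof.
have [c cI] : lam_le M.
  by have [/card_leE[f fI] _] := (card_eqPle _ _).1 M_card; exists f.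
pose k : M := to_elts kappa_M.
have dP x : exists d : M, small x -> val d = [set y | exists2 a : M, y = val a & x (c a)] :> set V.
  have [sx|nx] := pselect (small x); last by exists k.
  have [|r rE] := @M_range [set a : M | x (c a)].
    apply: small_sub (small_image (fun b => the k [set a | c a = b]) sx) => a xa.
    exists (c a) => //; apply: cI.
    by apply: (@theP _ k [set a' | c a' = c a]); exists a.
  exists r => _; rewrite rE; apply/seteqP; split=> y; first by move=> [a xa <-]; exists a.
  by move=> [a -> xa]; exists a.
have [d {}dP] := choice dP.
have oP (x : set lambda) : exists p : M * (lambda -> M), small x ->
    val p.1 ∈ kappa /\ (forall a, x a -> val (p.2 a) ∈ val p.1) /\
    forall a b, x a -> x b -> p.2 a = p.2 b -> a = b.
  have [[b [e xe]]|nx] := pselect (small x); last by exists (k, fun=> k).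
  have bM : val b ∈ M by apply: (M_trans kappa_M); exact: eltsP.
  have bk (i : val b) : val i ∈ M by apply: (M_trans bM); exact: eltsP.
  pose g a := the k [set v : M | exists2 i : val b, v = to_elts (bk i) & e i = a].
  have gP a : x a -> exists2 i : val b, g a = to_elts (bk i) & e i = a.
    move=> /xe[i _ ei]; apply: (@theP _ k [set v : M | exists2 i : val b,
      v = to_elts (bk i) & e i = a]).
    by exists (to_elts (bk i)), i.
  exists (to_elts bM, g) => _; split; first exact: eltsP.
  split=> /= [a /gP[i -> _]|a a' /gP[i -> <-] /gP[i' -> <-] ii']; first exact: eltsP.
  by congr e; apply: val_inj; have := f_equal val ii'.
have [oe oeP] := choice oP.
pose H : Type := (M + unit + unit + lambda)%type.
have lM : lam_le M by exists c.
have l1 := lam_le_unit kappa_reg kappa_lambda.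
have lsum := lam_le_sum kappa_reg kappa_lambda lambda_seq.
have lH : lam_le H by do !apply: (lsum) => //; exact: lam_le_lam.
pose h (p : H) (x : set lambda) : M := match p with
  | inl (inl (inl a)) => a | inl (inl (inr _)) => d x
  | inl (inr _) => (oe x).1 | inr a => (oe x).2 a end.
have lL : lam_le (fun_sym Lin + rel_sym Lin).
  by apply: (lsum) => //; exists (fun v : void => match v with end) => -[].
have sl := small_logic_Lww kappa_reg kappa_unc kappa_lambda.
have [I [ev [JB [B [lI lB hI los]]]]] := los kappa_reg kappa_unc kappa_lambda
  lambda_seq sl lL (A := fun=> in_structure M) (fun=> k) h lH.
have [U [UF UB Uf _]] := normal_filters_diag kappa_reg kappa_unc kappa_lambda
  lambda_seq nf lB lI lI B (fun i x => c (ev i x)) (fun _ _ => setT).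
have UI := filtI kappa_reg kappa_unc UF.
have Uex := filt_ex kappa_reg kappa_unc UF.
have Usub := filt_sub UF.
have Uall := filt_all UF.
have [A [cl [clS los']]] := los U UF UB.
have denU f (s : nat -> I) : den (cl \o s) f <->
    U [set x | den (A := in_structure M) (fun v => ev (s v) x) f].
  rewrite -sat_den los'; split; apply: Usub => x; first by move/sat_den.
  by move=> hx; apply/sat_den.
pose nt (i j : I) n := if n is 0 then i else j.
have memU i j : mem_in (cl i) (cl j) <-> U [set x | val (ev i x) ∈ val (ev j x)].
  exact: (denU (FIn 0 1) (nt i j)).
have eqU i j : cl i = cl j <-> U [set x | ev i x = ev j x].
  exact: (denU (FEq 0 1) (nt i j)).
have neqU i j : cl i <> cl j -> U [set x | ev i x <> ev j x].
  have := los' (Neg (Eq (Var Lin (l := Lww) 0) (Var Lin (l := Lww) 1))) (nt i j).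
  by move=> [+ _]; apply.
have [cst cstE] := choice (fun a => hI (inl (inl (inl a)))).
have cstx a x : ev (cst a) x = a by rewrite cstE.
have R_wf : well_founded (@mem_in A).
  apply: no_descent_wf => f hf.
  have [i iP] := choice (fun n => clS (f n)).
  have UE : U (\bigcap_n [set x | val (ev (i n.+1) x) ∈ val (ev (i n) x)]).
    apply: (filt_bigcap kappa_reg UF).
      by apply: small_countable => //; exact: countableP.
    by move=> n _; apply/memU; rewrite !iP; exact: hf.
  have [x _ hx] := Uex _ UE.
  exact: (wf_no_descent (f := fun n => val (ev (i n) x)) elem_wf (fun n => hx n Logic.I)).
have R_ext (a b : dom A) : (forall e, mem_in e a <-> mem_in e b) -> a = b.
  have [i <-] := clS a; have [j' <-] := clS b => ab.
  pose f := FImp (FAll 2 (FAnd (FImp (FIn 2 0) (FIn 2 1)) (FImp (FIn 2 1) (FIn 2 0))))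
    (FEq 0 1).
  have [_ /(_ _)/=] := denU f (nt i j'); apply.
    apply: Uall => x _; rewrite /= /upd /= => ext; apply/val_inj/V_ext => z.
    split=> zz.
      by have zM := M_trans (eltsP _) zz; have [e _] := ext (to_elts zM); exact: e.
    by have zM := M_trans (eltsP _) zz; have [_ e] := ext (to_elts zM); exact: e.
  by rewrite /upd /= => e; split=> /ab.
pose pi := collapse R_wf; pose N := collapse_set R_wf.
have piE a y : y ∈ pi a <-> exists2 b, mem_in b a & y = pi b := collapseE R_wf a y.
have piI : injective pi := collapse_inj R_ext.
have piN a : pi a ∈ N by apply/in_collapse_set; exists a.
have N_trans : transitive_set N by exact: collapse_set_trans.
pose F a : N := to_elts (piN a).
pose j a := F (cl (cst a)).
have FI : injective F by move=> a b /(f_equal val)/piI.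
have FS b : exists a, F a = b.
  by have /in_collapse_set[a ab] := eltsP b; exists a; apply: val_inj.
have FE a a' : mem_in a a' <-> mem_in (A := in_structure N) (F a) (F a').
  rewrite mem_inE; exact: (collapse_elem R_wf R_ext a a').
have j_elem : elementary j.
  move=> phi s; rewrite -[j \o s]/(F \o (cl \o (cst \o s)))
    -(iso_sat (B := in_structure N) FI FS FE) los'.
  have sE x : (fun v => ev ((cst \o s) v) x) = s by apply: funext => v; exact: cstx.
  split=> [hs|/Uex[x _]]; last by rewrite /= sE.
  by apply: Uall => x _; rewrite /= sE.
have jE a y : y ∈ val (j a) <-> exists2 i, U [set x | val (ev i x) ∈ val a] & y = pi (cl i).
  rewrite piE; split=> [[b + ->]|[i hi ->]].
    have [i <-] := clS b; rewrite memU => hi; exists i => //.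
    by apply: Usub hi => x /=; rewrite cstx.
  by exists (cl i) => //; apply/memU; apply: Usub hi => x /=; rewrite cstx.
have j_fix (a : M) : val a ∈ kappa -> val (j a) = val a.
  case: a => v vM; rewrite -[val (exist _ v vM)]/v => vk.
  elim/(well_founded_ind elem_wf): v vM vk => v IH vM vk.
  set a : M := exist _ v vM.
  have yM y : y ∈ v -> y ∈ M by move=> yv; apply: (M_trans (eltsP a)).
  have yk y : y ∈ v -> y ∈ kappa by apply: ord_trans (kappa_ord kappa_reg) vk.
  apply: V_ext => y; rewrite jE; split=> [[i hi ->]|yv].
    have [y' [y'v ey]] : exists y' : M, val y' ∈ v /\ cl i = cl (cst y').
      apply: contrapT => nex.
      have hU : U (\bigcap_(y in [set y : M | val y ∈ v]) [set x | ev i x <> y]).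
        apply: (filt_bigcap kappa_reg UF).
          apply: small_sub (small_image (fun y => the a [set b : M | y = val b])
            (small_elem (to_elts vk))) => b bv.
          exists (val b) => //; apply: val_inj.
          by have := @theP _ a [set b' : M | val b = val b']; move/(_ (ex_intro _ b erefl)).
        move=> y' y'v.
        have /neqU : cl i <> cl (cst y') by move=> e; apply: nex; exists y'.
        by apply: Usub => x /=; rewrite cstx.
      by have [x _ [xi /(_ (ev i x) xi)]] := Uex _ (UI _ _ hi hU).
    rewrite ey -[pi _]/(val (j y')); case: y' y'v {ey} => y' y'M y'v.
    by rewrite IH //; exact: yk.
  exists (cst (to_elts (yM y yv))).
    by apply: Uall => x _; rewrite /= cstx.
  by rewrite -[RHS]/(val (j (to_elts (yM y yv)))) IH //; exact: yk.
have [io ioE] := hI (inl (inr tt)); have [id idE] := hI (inl (inl (inr tt))).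
have [ie ieE] := choice (fun a => hI (inr a)).
have oU : pi (cl io) ∈ val (j k).
  by apply/jE; exists io => //; apply: Uall => x [sx _]; rewrite /= ioE; case: (oeP x sx).
have eU a : pi (cl (ie a)) ∈ pi (cl io).
  apply/piE; exists (cl (ie a)) => //; apply/memU.
  apply: Usub (UI _ _ (filt_idx UF) (filt_mem UF a)) => x [[sx _] xa].
  by rewrite /= ioE ieE; case: (oeP x sx) => _ [+ _]; apply.
have eI : injective (fun a => to_elts (eU a)).
  move=> a b /(f_equal val)/piI/eqU ab.
  have [x [sx _] [[/= xab xa] xb]] :=
    Uex _ (UI _ _ (UI _ _ ab (filt_mem UF a)) (filt_mem UF b)).
  move: xab; rewrite !ieE; case: (oeP x sx) => _ [_ +]; exact.
have jk_ord : is_ordinal (val (j k)).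
  have := den_ord (fun=> j k) N_trans => /=.
  move=> <-; apply/(sat_den (A := in_structure N) (fun=> j k) ord_fm).
  apply/(j_elem _ (fun=> k)).
  apply/(sat_den (A := in_structure M)); apply/den_ord => //=.
  exact: kappa_ord.
have lam_jk : lambda ∈ val (j k).
  have [//|e|e] := ord_trichotomy (proj1 lambda_card) jk_ord.
  - move: oU; rewrite -e => /(proj2 lambda_card)[_]; case.
    by apply/card_leE; exists (fun a => to_elts (eU a)).
  - have := ord_trans (proj1 lambda_card) e oU => /(proj2 lambda_card)[_]; case.
    by apply/card_leE; exists (fun a => to_elts (eU a)).
exists N, j; split=> //.
  exists k; split=> //; split; [exact: kappa_ord| |exact: j_fix].
  by move=> e; move: lam_jk; rewrite e => /kappa_lambda; exact: elem_irrefl.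
exists (pi (cl id)); first exact: piN.
apply/seteqP; split=> y.
  move=> /piE[b + ->]; have [i <-] := clS b; rewrite memU idE => hi.
  have hc : U [set x | x (c (ev i x))].
    apply: Usub (UI _ _ hi (filt_idx UF)) => x [/= + [sx _]].
    by rewrite -[_ ∈ _]/(elts (val (d x)) _) dP // => -[a /val_inj ->].
  have [b' hb'] := Uf i hc.
  have [x0 _ /= e0] := Uex _ hb'.
  exists (ev i x0) => //; congr pi; apply/eqU.
  by apply: Usub hb' => x /= e; rewrite cstx; apply: cI; rewrite e e0.
move=> [a _ <-]; apply/piE; exists (cl (cst a)) => //; apply/memU.
apply: Usub (UI _ _ (filt_idx UF) (filt_mem UF (c a))) => x [[sx _] xa] /=.
by rewrite idE cstx -[_ ∈ _]/(elts (val (d x)) _) dP //; exists a.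
Qed.

End Embedding.

(** * Transitive sets of size lambda *)

Lemma small_class_sub (X : set V) (b : V) : X `<=` b -> is_small_class X.
Proof. by move=> Xb; exists b, val => x /Xb xb; exists (to_elts xb). Qed.

Lemma small_class2 (a b : V) : is_small_class [set a; b].
Proof.
have [t ->] := V_cls a; have [u ->] := V_cls b.
apply: (@small_class_sub _ (cls (sup (fun i : bool => if i then t else u)))).
by move=> _ [] ->; apply/elem_cls; [exists true|exists false].
Qed.

Definition upair (a b : V) : V := mkV [set a; b].

Lemma in_upair z a b : z ∈ upair a b <-> z = a \/ z = b.
Proof. exact: (in_mkV z (small_class2 a b)). Qed.

Section Hull.

Variables kappa lambda : V.
Hypothesis kappa_reg : regular kappa.
Hypothesis kappa_unc : ~ countable kappa.
Hypothesis lambda_card : is_cardinal lambda.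
Hypothesis kappa_lambda : kappa `<=` lambda.
Hypothesis lambda_seq : [set: lt_seq kappa lambda] #= lambda.

Notation small := (small kappa).
Notation lam_le := (lam_le lambda).

Lemma lambda_elem_ord a : a ∈ lambda -> is_ordinal a.
Proof. exact: ord_elem (proj1 lambda_card). Qed.

(** These sets belong to every transitive set that contains the elements of [lambda]
    and is closed under short sequences. *)
Inductive hered : V -> Prop :=
| HeredOrd a of a ∈ lambda : hered a
| HeredSet (y : V) (a : kappa) (s : val a -> V) of
    y = range s :> set V & (forall i, hered (s i)) : hered y.

Lemma hered_small (X : set V) (y : V) : y = X :> set V -> small X ->
  (forall z, X z -> hered z) -> hered y.
Proof.
move=> yX /(small_exact kappa_reg)[a [s Xs]] Xh.
apply: (@HeredSet y a s) => [|i]; first by rewrite yX.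
by apply: Xh; rewrite Xs; exists i.
Qed.

Section Model.

Variables (Q : Type) (D : Q -> V) (op : V -> V).
Hypothesis lQ : lam_le Q.
Hypothesis D_hered : forall q y, y ∈ D q -> hered y.
Hypothesis op_hered : forall x y, y ∈ op x -> hered y.

Let zero : kappa := projT1 (cid (kappa_zero kappa_reg)).
Let zeroP (i : val zero) : False := projT2 (cid (kappa_zero kappa_reg)) _ (eltsP i).
Let one : kappa := projT1 (cid (kappa_two kappa_reg)).
Let one0 : val one := projT1 (cid (projT2 (cid (kappa_two kappa_reg)))).

Let gen : Type := (lambda + Q + kappa + unit)%type.

Let gen_ar (g : gen) : kappa := match g with
  | inl (inl _) => zero | inl (inr a) => a | inr _ => one end.

Let gen_op (g : gen) : (val (gen_ar g) -> V) -> V := match g with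
  | inl (inl (inl a)) => fun=> val a
  | inl (inl (inr q)) => fun=> D q
  | inl (inr a) => fun s => mkV (range s)
  | inr _ => fun s => op (s one0) end.

Let ev : wtree gen_ar -> V := wfold gen_op.

Let lam_le_trees : lam_le (wtree gen_ar).
Proof.
have lsum := lam_le_sum kappa_reg kappa_lambda lambda_seq.
apply: (lam_le_wtree kappa_reg lambda_seq).
apply: (lsum); last exact: (lam_le_unit kappa_reg kappa_lambda).
apply: (lsum); last exact: lam_le_kappa.
by apply: (lsum) => //; exact: lam_le_lam.
Qed.

Let range_class : is_small_class (range ev).
Proof.
have [c cI] := lam_le_trees.
exists lambda, (fun a => the V0 [set y | exists2 t, y = ev t & c t = a]).
move=> _ [t _ <-]; exists (c t) => //.
have [|t' -> /cI -> //] := @theP _ V0 [set y | exists2 t', y = ev t' & c t' = c t].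
by exists (ev t), t.
Qed.

Let M : V := mkV (range ev).

Let in_M y : y ∈ M <-> exists t, y = ev t.
Proof. by rewrite in_mkV //; split=> [[t _ <-]|[t ->]]; exists t. Qed.

Let M_leaf g : gen_ar g = zero -> forall y, (forall s, @gen_op g s = y) -> y ∈ M.
Proof.
move=> e y h; apply/in_M.
exists (@wnode kappa gen gen_ar g (fun i =>
  match zeroP (eq_rect _ (fun a : kappa => val a) i _ e) with end)).
by rewrite /ev /= h.
Qed.

Let M_range (a : kappa) (s : val a -> V) : (forall i, s i ∈ M) ->
  exists2 r, r ∈ M & r = range s :> set V.
Proof.
move=> sM; have [t tP] := choice (fun i => (in_M (s i)).1 (sM i)).
have e : (fun i => ev (t i)) = s by apply: funext => i; rewrite tP.
exists (ev (@wnode kappa gen gen_ar (inl (inr a)) t)); first by apply/in_M; eexists.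
rewrite -[LHS]/(elts (mkV (range (fun i => ev (t i))))) e mkVE //.
by exists (val a), s.
Qed.

Let M_hered y : hered y -> y ∈ M.
Proof.
move=> hy; elim: y / hy => [y yl|y a s ys _ sM].
  by apply: (@M_leaf (inl (inl (inl (to_elts yl))))).
have [r rM rs] := M_range sM.
by have -> : y = r by apply: elts_inj; rewrite ys.
Qed.

Let M_ord a : a ∈ lambda -> a ∈ M.
Proof. by move=> /HeredOrd/M_hered. Qed.

Let M_upair a b : a ∈ M -> b ∈ M -> exists2 u, u ∈ M & is_upair u a b.
Proof.
move=> aM bM; have [o [i [j ij]]] := kappa_two kappa_reg.
have [|r rM re] := @M_range o (fun k => if pselect (k = i) then a else b).
  by move=> k; case: pselect.
exists r => //; rewrite /is_upair re; apply/seteqP; split=> y.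
  by move=> [k _ <-]; case: pselect; [left|right].
move=> [->|->]; [exists i => //|exists j => //]; first by case: pselect.
by case: pselect => //= /esym.
Qed.

(** The sets named by terms built from the elements of [lambda] and the sets [D q] by
    [op] and by the formation of small sets.  There are [lambda] many terms, and
    the elements of [D q] and [op x] are named as they are hereditarily small. *)
Lemma hull_exists : exists M : V, [/\ transitive_set M, M #= lambda,
  seq_closed kappa M, (forall q, D q ∈ M) /\ (forall x, x ∈ M -> op x ∈ M) &
  forall y, hered y -> y ∈ M].
Proof.
exists M; split=> //.
- move=> y /in_M[[g s] ->] z; case: g s => [[[a|q]|a]|[]] s.
  + by move=> za; apply: M_ord; apply: ord_trans (proj1 lambda_card) (eltsP a) za.
  + by move=> /D_hered/M_hered.
  + move=> zs; have {zs} : z ∈ mkV (range (fun i => ev (s i))) := zs.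
    rewrite in_mkV; first by move=> [i _ <-]; apply/in_M; exists (s i).
    by exists (val a), (fun i => ev (s i)).
  + by move=> /op_hered/M_hered.
- apply/card_eqPle; split; apply/card_leE.
    have [c cI] := lam_le_trees; have [t tP] := choice (fun y : M => (in_M _).1 (eltsP y)).
    exists (fun y => c (t y)) => y z /cI tyz; apply: val_inj.
    by rewrite tP tyz -tP.
  by exists (fun a => to_elts (M_ord (eltsP a))) => a b /(f_equal val) /= /val_inj.
- move=> [a s]; split; last first.
    by have [r rM re] := M_range (fun i => eltsP (s i)); exists r.
  have pairM (i : val a) : exists2 p, p ∈ M & is_pair p (val i) (val (s i)).
    have iM : val i ∈ M by apply/M_ord/kappa_lambda/(kappa_elem_sub kappa_reg (eltsP i)).
    have [u uM uP] := M_upair iM iM.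
    have [v vM vP] := M_upair iM (eltsP (s i)).
    by have [p pM pP] := M_upair uM vM; exists p => //; exists u, v.
  have [p pP] := choice (fun i => let: ex_intro2 p h1 h2 := pairM i in ex_intro _ p (conj h1 h2)).
  have [g gM ge] := @M_range a p (fun i => proj1 (pP i)).
  exists g => // q; rewrite -[q ∈ g]/(elts g q) ge; split=> [[i _ <-]|[i [u [v [hu hv hq]]]]].
    by exists i; exact: proj2 (pP i).
  have [_ [u' [v' [hu' hv' hp]]]] := pP i; exists i => //; apply: elts_inj.
  rewrite hp hq; congr [set _; _]; apply: elts_inj; rewrite ?hu ?hv ?hu' ?hv' //.
- split=> [q|x /in_M[t ->]]; first by apply: (@M_leaf (inl (inl (inr q)))).
  apply/in_M; exists (@wnode kappa gen gen_ar (inr tt) (fun=> t)).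
  by [].
Qed.

End Model.

(** The elements of [X] with few predecessors in [X] form a set that is not small,
    since the first element of [X] outside a small set of this kind would have few
    predecessors.  An increasing function is chosen there by recursion: each step
    excludes the predecessors of fewer than [kappa] many such elements. *)
Lemma increasing_function (X : set V) : X `<=` lambda -> ~ small X ->
  exists c : V -> V, forall g, g ∈ kappa ->
    [/\ X (c g), g ∈ c g & forall g', g' ∈ g -> c g' ∈ c g].
Proof.
move=> Xl nX.
have oX d : X d -> is_ordinal d by move=> /Xl/lambda_elem_ord.
pose Y := [set d | X d /\ small (X `&` d)].
have nY : ~ small Y.
  move=> sY; apply: nX; apply: small_sub (sY) => d Xd; apply: contrapT => nYd.
  have [e [Xe nYe] emin] : exists2 e, X e /\ ~ Y e &
      forall z, z ∈ e -> ~ (X z /\ ~ Y z).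
    by apply: (wf_min elem_wf (P := fun e => X e /\ ~ Y e)); exists d.
  apply: nYe; split=> //; apply: small_sub sY => z [Xz ze].
  by apply: contrapT => nYz; apply: (emin z ze).
pose F (g : V) (rec : forall g', g' ∈ g -> V) :=
  the V0 [set d | [/\ Y d, g ∈ d & forall g' (h : g' ∈ g), rec g' h ∈ d]].
pose c := Fix elem_wf (fun=> V) F.
have cE g : c g = the V0 [set d | [/\ Y d, g ∈ d & forall g', g' ∈ g -> c g' ∈ d]].
  rewrite /c Fix_eq // => {}g p p' pp'; rewrite /F; congr the.
  apply: funext => d; apply: propext; split=> -[Yd gd h]; split=> // g' h';
    by [rewrite -pp'|rewrite pp'].
suff cP g : g ∈ kappa -> [/\ Y (c g), g ∈ c g & forall g', g' ∈ g -> c g' ∈ c g].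
  by exists c => g /cP[[]].
elim/(well_founded_ind elem_wf): g => g IH gk.
rewrite [c g]cE.
apply: (@theP _ V0 [set d | [/\ Y d, g ∈ d & forall g', g' ∈ g -> c g' ∈ d]]).
apply: contrapT => nd; apply: nY.
have gk' g' : g' ∈ g -> g' ∈ kappa by exact: ord_trans (kappa_ord kappa_reg) gk.
have og : is_ordinal g := ord_elem (kappa_ord kappa_reg) gk.
apply: (@small_sub _ _ _ (g `|` [set g] `|`
    \bigcup_(g' in g) ((X `&` c g') `|` [set c g']))); last first.
  apply: smallU => //.
    by apply: smallU => //; [exact: (small_elem (to_elts gk))|exact: small1].
  apply: small_bigcup => //; first exact: (small_elem (to_elts gk)).
  move=> g' g'g; apply: smallU => //; last exact: small1.
  by have [[]] := IH g' g'g (gk' g' g'g).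
move=> d Yd; have od := oX d (proj1 Yd).
have [dg|->|gd] := ord_trichotomy od og; [by left; left|by left; right|].
right; apply: contrapT => H; apply: nd; exists d; split=> // g' g'g.
have [[Xc _] _ _] := IH g' g'g (gk' g' g'g).
have [//|e|dc] := ord_trichotomy (oX _ Xc) od; case: H; exists g' => //.
  by right.
by left; split=> //; case: Yd.
Qed.

End Hull.

(** * Coherent values from embeddings *)

Section Coherence.

Variables kappa lambda : V.
Hypothesis kappa_reg : regular kappa.
Hypothesis kappa_unc : ~ countable kappa.
Hypothesis lambda_card : is_cardinal lambda.
Hypothesis kappa_lambda : kappa `<=` lambda.
Hypothesis lambda_seq : [set: lt_seq kappa lambda] #= lambda.
Hypothesis ep : embedding_property kappa lambda.

Notation small := (small kappa).
Notation lam_le := (lam_le lambda).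
Notation idx_set := (@idx_set kappa lambda).

(** The representation of an index set inside the models. *)
Definition hat (x : set lambda) : V := mkV (val @` x).

Lemma in_hat x v : v ∈ hat x <-> exists2 a : lambda, x a & v = val a.
Proof.
rewrite in_mkV; last by exists lambda, val => _ [a _ <-]; exists a.
by split=> [[a xa <-]|[a xa ->]]; exists a.
Qed.

Lemma in_hat_val x (a : lambda) : val a ∈ hat x <-> x a.
Proof. by rewrite in_hat; split=> [[b xb /val_inj ->//]|xa]; exists a. Qed.

Lemma hat_inj : injective hat.
Proof. by move=> x y e; apply/seteqP; split=> a /in_hat_val; rewrite (e, =^~ e) => /in_hat_val. Qed.

Lemma hat_elem_irrefl x (a : lambda) : x a -> ~ hat x ∈ val a.
Proof. by move=> /in_hat_val/elem_asym. Qed.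

Lemma idx_class (g : set lambda -> V) : is_small_class (g @` idx_set).
Proof.
have [kc kcI] := lam_le_small_set kappa_reg kappa_lambda lambda_seq (lam_le_lam lambda).
exists lambda, (fun b => g (the set0 [set x | small x /\ kc x = b])) => _ [x [sx _] <-].
exists (kc x) => //; congr g.
have [|sy /kcI -> //] := @theP _ set0 [set y | small y /\ kc y = kc x].
by exists x.
Qed.

Lemma idx_class_sub (g : set lambda -> V) (P : set (set lambda)) :
  is_small_class (g @` (idx_set `&` P)).
Proof.
have [b [G gG]] := idx_class g; exists b, G.
by apply: subset_trans gG => _ [x [ix _] <-]; exists x.
Qed.

Lemma hered_hat x : small x -> hered kappa lambda (hat x).
Proof.
move=> sx; apply: (hered_small kappa_reg (X := val @` x)); last first.
- by move=> _ [a _ <-]; apply: HeredOrd; exact: eltsP.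
- exact: small_image.
- by apply/seteqP; split=> v; [case/in_hat => a xa ->; exists a|case=> a xa <-; apply/in_hat_val].
Qed.

Lemma hered_upair a b : hered kappa lambda a -> hered kappa lambda b ->
  hered kappa lambda (upair a b).
Proof.
move=> ha hb; apply: (hered_small kappa_reg (X := [set a; b])).
- by apply: mkVE; exact: small_class2.
- by apply: smallU => //; exact: small1.
- by move=> _ [] ->.
Qed.

(** The pair of two ordinals with [g] in [d] is coded by the set of its components,
    which the membership relation tells apart. *)
Definition pair_fm c g d := FEx 9 (FAnd (FIn 9 c) (FAnd (FIn g 9) (FAnd (FIn d 9) (FIn g d)))).

(** Every set [x] (variable 3) whose trace on [kappa] (0) is an ordinal has
    a trace on [lambda] (1) in the set (2) of index sets, unless an increasing
    function from [kappa] to that trace is coded as a set of pairs (8). *)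
Definition cover_fm : fm :=
  FAll 3 (FImp (FAll 4 (FImp (FIn 4 0) (FImp (FIn 4 3) (FAll 5 (FImp (FIn 5 4) (FIn 5 3))))))
    (FOr
      (FEx 6 (FAnd (FIn 6 2) (FAll 7 (FAnd (FImp (FIn 7 6) (FAnd (FIn 7 3) (FIn 7 1)))
        (FImp (FAnd (FIn 7 3) (FIn 7 1)) (FIn 7 6))))))
      (FEx 8 (FAnd
        (FAll 4 (FImp (FIn 4 0) (FEx 5 (FAnd (FIn 5 1) (FAnd (FIn 5 3) (pair_fm 8 4 5))))))
        (FAll 4 (FAll 5 (FAll 6 (FAll 7 (FImp (FIn 4 6) (FImp (pair_fm 8 4 5)
          (FImp (pair_fm 8 6 7) (FIn 5 7)))))))))))).

Section Family.

Variables (J : Type) (f : J -> set lambda -> lambda).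
Hypothesis lJ : lam_le J.

Let Pset : V := mkV (hat @` idx_set).
Let Fset j a : V := mkV (hat @` (idx_set `&` [set x | f j x = a])).
Let Rset j : V := mkV (hat @` (idx_set `&` [set x | x (f j x)])).
Let Gset j : V := mkV ((fun x => upair (hat x) (val (f j x))) @`
  (idx_set `&` [set x | x (f j x)])).

Let in_Pset y : y ∈ Pset <-> exists2 x, idx_set x & y = hat x.
Proof.
rewrite in_mkV; last exact: idx_class.
by split=> [[x ix <-]|[x ix ->]]; exists x.
Qed.

Let in_Fset j a y : y ∈ Fset j a <-> exists x, [/\ idx_set x, f j x = a & y = hat x].
Proof.
rewrite in_mkV; last exact: idx_class_sub.
by split=> [[x [ix fx] <-]|[x [ix fx ->]]]; exists x.
Qed.

Let in_Rset j y : y ∈ Rset j <-> exists x, [/\ idx_set x, x (f j x) & y = hat x].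
Proof.
rewrite in_mkV; last exact: idx_class_sub.
by split=> [[x [ix fx] <-]|[x [ix fx ->]]]; exists x.
Qed.

Let in_Gset j y : y ∈ Gset j <->
  exists x, [/\ idx_set x, x (f j x) & y = upair (hat x) (val (f j x))].
Proof.
rewrite in_mkV; last exact: idx_class_sub.
by split=> [[x [ix fx] <-]|[x [ix fx ->]]]; exists x.
Qed.

Let Q : Type := (J * lambda + J + J + option bool)%type.

Let D (q : Q) : V := match q with
  | inl (inl (inl p)) => Fset p.1 p.2
  | inl (inl (inr j)) => Rset j
  | inl (inr j) => Gset j
  | inr None => Pset
  | inr (Some true) => kappa
  | inr (Some false) => lambda end.

Let D_hered q y : y ∈ D q -> hered kappa lambda y.
Proof.
have hh x : idx_set x -> hered kappa lambda (hat x) by case=> sx _; exact: hered_hat.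
case: q => [[[[j a]|j]|j]|[[]|]] /=.
- by move=> /in_Fset[x [ix _ ->]]; exact: hh.
- by move=> /in_Rset[x [ix _ ->]]; exact: hh.
- move=> /in_Gset[x [ix _ ->]]; apply: hered_upair; first exact: hh.
  by apply: HeredOrd; exact: eltsP.
- by move=> /kappa_lambda; exact: HeredOrd.
- exact: HeredOrd.
- by move=> /in_Pset[x ix ->]; exact: hh.
Qed.

Let tr (y : V) : set V := y `&` lambda.

Let cspec (y : V) (c : V -> V) := forall g, g ∈ kappa ->
  [/\ tr y (c g), g ∈ c g & forall g', g' ∈ g -> c g' ∈ c g].

Let cfun (y : V) : V -> V := the id [set c | cspec y c].

(* The graph of an increasing function from [kappa] to the trace of [y] on
   [lambda]. *)
Let op (y : V) : V := if `[< small (tr y) >] then V0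
  else mkV ((fun g => upair g (cfun y g)) @` kappa).

Let in_op y u : ~ small (tr y) ->
  (u ∈ op y <-> exists2 g, g ∈ kappa & u = upair g (cfun y g)).
Proof.
move=> ns; rewrite /op; case: asboolP => // _.
rewrite in_mkV; first by split=> [[g gk <-]|[g gk ->]]; exists g.
by exists kappa, (fun g => upair (val g) (cfun y (val g))) => _ [g gk <-];
  exists (to_elts gk).
Qed.

Let cfunP y : ~ small (tr y) -> cspec y (cfun y).
Proof.
move=> ns; apply: (@theP _ id [set c | cspec y c]).
have trl : tr y `<=` lambda by move=> v [].
by have [c cP] := increasing_function kappa_reg kappa_unc lambda_card trl ns; exists c.
Qed.

Let op_hered x y : y ∈ op x -> hered kappa lambda y.
Proof.
have [s|ns] := pselect (small (tr x)).
  rewrite /op; case: asboolP => // _.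
  by rewrite /V0 => /elem_cls[[]].
move=> /(in_op _ ns)[g gk ->]; have [[_ cl] _ _] := cfunP ns gk.
by apply: hered_upair; apply: HeredOrd => //; exact: kappa_lambda.
Qed.

(** Here [E i a] says that j''lambda belongs to the image of the set of all [x] with
    f_i(x) = a.  All the conditions follow by transferring first order statements
    about these sets, once j''lambda is known to be in the image of the set of all
    index sets; the statement transferred for this purpose is [cover_fm].  The
    unordered pair of [x] and f_i(x) is used for the values that belong to [x],
    where it determines its components. *)
Lemma embedding_coherent : exists E : J -> lambda -> Prop,
  [/\ forall i c, (forall x, idx_set x -> x c -> x (f i x)) -> exists a, E i a,
      forall i j a b c, E i a -> E j b ->
        exists x, [/\ idx_set x, x c, f i x = a & f j x = b] &
      forall i j a, E i a -> (forall x, idx_set x -> f i x = a -> x (f j x)) ->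
        exists b, E j b].
Proof.
have lQ : lam_le Q.
  have lsum := lam_le_sum kappa_reg kappa_lambda lambda_seq.
  apply: (lsum); last exact: (lam_le_option kappa_reg kappa_lambda lambda_seq
    (lam_le_bool kappa_reg kappa_lambda)).
  do 2!apply: (lsum) => //; exact: (lam_le_prod kappa_reg lambda_seq lJ (lam_le_lam lambda)).
have [M [M_trans M_card M_closed [DM opM] M_hered]] := hull_exists kappa_reg
  lambda_card kappa_lambda lambda_seq lQ D_hered op_hered.
have [N [j [N_trans j_elem [k [kE [_ _ j_fix] lam_jk]] [y yN yE]]]] :=
  ep M_trans M_card (DM (inr (Some true))) M_closed.
have tr_den g (s : nat -> M) : den (A := in_structure M) s g <->
    den (A := in_structure N) (j \o s) g.
  by rewrite -!sat_den; exact: j_elem.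
(* An environment is a list; its default value is never looked up. *)
pose env T (d : T) (l : seq T) n := nth d l n.
have envE (l : seq M) : j \o env _ k l = env _ (j k) [seq j a | a <- l].
  apply: funext => n; rewrite /env /=; elim: l n => [|a l IH] [|n] //=.
have transfer g (l : seq M) : den (A := in_structure M) (env _ k l) g ->
    den (A := in_structure N) (env _ (j k) [seq j a | a <- l]) g.
  by rewrite -envE => /tr_den.
have j_mem a b : val a ∈ val b <-> val (j a) ∈ val (j b).
  exact: (tr_den (FIn 0 1) (env _ k [:: a; b])).
pose Pm : M := to_elts (DM (inr None)).
pose lm : M := to_elts (DM (inr (Some false))).
pose Fm i a : M := to_elts (DM (inl (inl (inl (i, a))))).
pose Rm i : M := to_elts (DM (inl (inl (inr i)))).
pose Gm i : M := to_elts (DM (inl (inr i))).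
have MT (b : M) z : z ∈ val b -> z ∈ M by apply: M_trans; exact: eltsP.
have NT (b : N) z : z ∈ val b -> z ∈ N by apply: N_trans; exact: eltsP.
have om (a : lambda) : val a ∈ M by apply/M_hered/HeredOrd/eltsP.
have jk_ord : is_ordinal (val (j k)).
  have := den_ord (fun=> j k) N_trans => /= <-.
  have /tr_den // : den (A := in_structure M) (fun=> k) ord_fm.
  by apply/den_ord => //=; rewrite kE; exact: kappa_ord.
pose yN' : N := to_elts yN.
have in_y z : z ∈ y <-> exists a : M, z = val (j a).
  rewrite -[z ∈ y]/(elts y z) yE; split=> [[a _ <-]|[a ->]]; by exists a.
have [x' x'P x'E] : exists2 x' : N, val x' ∈ val (j Pm) &
    forall w, w ∈ val x' <-> w ∈ y /\ w ∈ val (j lm).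
  have cover : den (A := in_structure M) (env _ k [:: k; lm; Pm]) cover_fm.
    move=> z /= hz; rewrite /upd /env /= in hz *.
    pose X : set lambda := [set a | val a ∈ val z].
    have [sX|nX] := pselect (small X); [left|right].
      have iX : idx_set X.
        split=> // a b Xa ak ba.
        move: ak; rewrite -kE => ak.
        exact: (hz (to_elts (om a)) ak Xa (to_elts (om b)) ba).
      have XP : hat X ∈ Pset by apply/in_Pset; exists X.
      exists (to_elts (MT Pm _ XP)); split; first exact: XP.
      move=> w; rewrite ?mem_inE; split.
        by move=> /in_hat[a Xa wa]; rewrite wa; split=> //; exact: eltsP.
      by move=> [wz wl]; apply/in_hat; exists (to_elts wl).
    have ntr : ~ small (tr (val z)).
      have [a0 _] := lambda_inh kappa_reg kappa_lambda.
      move=> st; apply: nX; apply: small_sub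
        (small_image (fun v => the a0 [set a | val a = v]) st) => a Xa.
      exists (val a); first by split=> //; exact: eltsP.
      by apply: val_inj; apply: (@theP _ a0 [set b | val b = val a]); exists a.
    have cP := cfunP ntr.
    pose om' : M := to_elts (opM _ (eltsP z)).
    have pairM (u g d : M) : val u ∈ op (val z) -> val g ∈ val u -> val d ∈ val u ->
        val g ∈ val d -> val g ∈ kappa /\ val d = cfun (val z) (val g).
      move=> /(in_op _ ntr)[g0 g0k ->]; have [_ g0c _] := cP _ g0k.
      move=> /in_upair[->|->] /in_upair[->|->] //.
      - by move=> /elem_irrefl.
      - by move=> /(elem_asym g0c).
      - by move=> /elem_irrefl.
    exists om'; split.
      move=> g gk; rewrite ?mem_inE kE in gk; have [[cz cl] gc _] := cP _ gk.
      exists (to_elts (MT lm _ cl)); split=> //; split=> //.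
      have uop : upair (val g) (cfun (val z) (val g)) ∈ op (val z).
        by apply/in_op => //; exists (val g).
      exists (to_elts (MT om' _ uop)); split=> //.
      by split; [|split] => //; apply/in_upair; [left|right].
    move=> g d g' d' gg' [u [uo [gu [du gd]]]] [u' [uo' [gu' [du' gd']]]].
    have [_ dE] := pairM u g d uo gu du gd.
    have [g'k d'E] := pairM u' g' d' uo' gu' du' gd'.
    rewrite ?mem_inE dE d'E; have [_ _] := cP _ g'k; by apply.
  have := transfer _ _ cover => /= /(_ yN').
  rewrite /upd /env /=; case.
  - (* The trace of j''M on j(kappa) is [kappa], as [j] fixes the elements of [kappa]. *)
    move=> b bk by' g gb; rewrite ?mem_inE in bk by' gb *.
    have /in_y[b0 b0E] : val b ∈ y by [].
    move: bk gb; rewrite b0E -j_mem => b0k.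
    rewrite j_fix // => gb0.
    have gk : val g ∈ val k.
      by move: b0k; rewrite kE => b0k; apply: ord_trans (kappa_ord kappa_reg) b0k gb0.
    by apply/in_y; exists (to_elts (MT _ _ gb0)); rewrite j_fix.
  - move=> [x' [x'P hx']]; exists x' => // w; split=> [wx|[wy wl]].
      by have [h _] := hx' (to_elts (NT _ _ wx)); exact: (h wx).
    have [_ h] := hx' (to_elts (NT _ _ wl)); exact: (h (conj wy wl)).
  - move=> [c [ctot cinc]]; exfalso.
    pose Pr (g d : N) := exists u : N,
      [/\ val u ∈ val c, val g ∈ val u, val d ∈ val u & val g ∈ val d].
    have gP (g : N) : exists b : M, val g ∈ val (j k) -> val b ∈ lambda /\ Pr g (j b).
      have [gk|ngk] := pselect (val g ∈ val (j k)); last by exists k.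
      have [d [dl [dy [u [uc [gu [du gd]]]]]]] := ctot g gk.
      have /in_y[b bE] : val d ∈ y by [].
      have db : d = j b by apply: val_inj.
      exists b => _; split.
        by move: dl; rewrite ?mem_inE db -(j_mem b lm).
      by exists u; rewrite -db; split.
    have [h hP] := choice gP.
    have lN : lambda ∈ N := NT _ _ lam_jk.
    have lsub v : v ∈ lambda -> v ∈ val (j k) by exact: ord_trans jk_ord lam_jk.
    (* [h] is an increasing function from j(kappa) to [lambda], which is an element
       of j(kappa): iterated from [lambda], it gives a descending sequence. *)
    pose a := fix a n : N := if n is n.+1 then
        (if pselect (val (h (a n)) ∈ N) is left hN then to_elts hN else j k)
      else to_elts lN.
    have ak n : val (a n) ∈ val (j k) /\ val (a n.+1) = val (h (a n)).
      have step m : val (a m) ∈ val (j k) -> val (a m.+1) = val (h (a m)).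
        move=> /hP[hl _] /=; case: pselect => // nN; exfalso; apply: nN.
        exact: NT (lsub _ hl).
      elim: n => [|n [IH1 IH2]]; first by split; [exact: lam_jk|apply: step].
      have ak' : val (a n.+1) ∈ val (j k).
        by rewrite IH2; apply: lsub; case: (hP _ IH1).
      by split=> //; apply: step.
    apply: (wf_no_descent (f := fun n => val (a n)) elem_wf); elim=> [|n IH].
      by have [a0k ->] := ak 0; case: (hP _ a0k).
    have [ank anE] := ak n; have [anSk anSE] := ak n.+1.
    rewrite anSE anE j_mem.
    have [_ [u [uc gu du gd]]] := hP _ ank; have [_ [u' [uc' gu' du' gd']]] := hP _ anSk.
    have := cinc (a n.+1) (j (h (a n.+1))) (a n) (j (h (a n))) IH.
    by apply; [exists u'|exists u].
have x'l w : w ∈ val x' <-> exists2 b : lambda, True & w = val (j (to_elts (om b))).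
  rewrite x'E in_y; split=> [[[b ->]]|[b _ ->]].
    rewrite -(j_mem b lm) => bl; exists (to_elts bl) => //.
    by congr (val (j _)); apply: val_inj.
  split; first by exists (to_elts (om b)).
  by rewrite -(j_mem _ lm); exact: eltsP.
pose E i a := val x' ∈ val (j (Fm i a)).
have ER i : val x' ∈ val (j (Rm i)) -> exists b, E i b.
  move=> x'R.
  pose g1 := FAll 3 (FImp (FIn 3 0) (FEx 4 (FAnd (FIn 4 3) (FEx 5 (FAnd (FIn 5 1)
    (FAnd (FIn 3 5) (FIn 4 5))))))).
  have /transfer/= : den (A := in_structure M) (env _ k [:: Rm i; Gm i]) g1.
    rewrite /= /upd /env /= => z /in_Rset[x [ix xf zE]].
    exists (to_elts (om (f i x))); rewrite ?mem_inE; split.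
      by rewrite zE; apply/in_hat_val.
    have uG : upair (hat x) (val (f i x)) ∈ Gset i by apply/in_Gset; exists x.
    exists (to_elts (MT (Gm i) _ uG)); rewrite ?mem_inE; split=> //.
    by split; apply/in_upair; [left|right].
  rewrite /upd /env /= => /(_ x' x'R)[b [bx [u [uG [xu bu]]]]].
  have /x'l[b0 _ b0E] : val b ∈ val x' by [].
  exists b0.
  pose g2 := FAll 3 (FAll 4 (FImp (FIn 2 3) (FImp (FIn 4 0)
    (FImp (FIn 3 4) (FImp (FIn 2 4) (FIn 3 1)))))).
  have /transfer/= : den (A := in_structure M) (env _ k [:: Gm i; Fm i b0; to_elts (om b0)]) g2.
    rewrite /= /upd /env /= => z v; rewrite ?mem_inE => bz /in_Gset[x [ix xf ->]].
    have nf := hat_elem_irrefl xf.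
    move=> /in_upair[zE|zE] /in_upair[bE|bE].
    - by move: bz; rewrite bE zE => /elem_irrefl.
    - by apply/in_Fset; exists x; split=> //; apply/esym/val_inj.
    - by move: bz; rewrite bE zE => /nf.
    - by move: bz; rewrite bE zE => /elem_irrefl.
  rewrite /upd /env /= => /(_ x' u); rewrite ?mem_inE -b0E; exact.
exists E; split.
- move=> i c0 h; apply: ER.
  pose g := FAll 3 (FImp (FIn 3 0) (FImp (FIn 1 3) (FIn 3 2))).
  have /transfer/= : den (A := in_structure M) (env _ k [:: Pm; to_elts (om c0); Rm i]) g.
    rewrite /= /upd /env /= => z /in_Pset[x ix zE] xc.
    have {xc} : val c0 ∈ val z := xc.
    have {}zE : val z = hat x := zE; rewrite zE => /in_hat_val xc.
    by apply/in_Rset; exists x; split=> //; exact: h.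
  rewrite /upd /env /=; apply=> //.
  by apply/x'l; exists c0.
- move=> i i' a b c0 ia ib; apply: contrapT => H.
  pose g := FAll 3 (FImp (FIn 3 0) (FImp (FIn 3 1) (FImp (FIn 2 3) (FIn 3 3)))).
  have /transfer/= : den (A := in_structure M) (env _ k [:: Fm i a; Fm i' b; to_elts (om c0)]) g.
    rewrite /= /upd /env /= => z /in_Fset[x [ix xa zE]] /in_Fset[x0 [_ xb]].
    have {}zE : val z = hat x := zE; rewrite -[elem _ _]/(val c0 ∈ val z).
    rewrite -[sval z]/(val z) zE => /hat_inj e /in_hat_val xc.
    by case: H; exists x; split=> //; rewrite e.
  rewrite /upd /env /= => /(_ x' ia ib); rewrite ?mem_inE => h.
  by apply: (elem_irrefl (h _)); apply/x'l; exists c0.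
- move=> i i' a ia h; apply: ER.
  pose g := FAll 3 (FImp (FIn 3 0) (FIn 3 1)).
  have /transfer/= : den (A := in_structure M) (env _ k [:: Fm i a; Rm i']) g.
    rewrite /= /upd /env /= => z /in_Fset[x [ix xa zE]].
    by apply/in_Rset; exists x; split=> //; exact: h.
  by rewrite /upd /env /=; apply.
Qed.

End Family.

Lemma embedding_coherent_values : coherent_values kappa lambda.
Proof. by move=> J lJ f; exact: embedding_coherent. Qed.

End Coherence.

(** * The equivalence *)

Theorem theorem12 (kappa lambda : V) :
  regular kappa -> ~ countable kappa -> is_cardinal lambda ->
  kappa `<=` lambda -> [set: lt_seq kappa lambda] #= lambda ->
  (embedding_property kappa lambda <->
     compact_type_omission kappa (Lkk kappa) lambda) /\
  (compact_type_omission kappa (Lkk kappa) lambda <->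
     compact_type_omission kappa Lww lambda).
Proof.
move=> reg unc lcard kl lseq.
have sww := small_logic_Lww reg unc kl.
have skk := small_logic_Lkk reg kl.
have coh := coherent_values_normal reg kl lseq.
have nf_c l (sl : small_logic kappa lambda l) :
    compact_type_omission kappa l lambda -> normal_filters kappa lambda.
  by move=> c; exact/coh/(compact_coherent_values reg unc kl lseq sl c).
have c_nf l (sl : small_logic kappa lambda l) :
    normal_filters kappa lambda -> compact_type_omission kappa l lambda.
  by move=> nf; exact: normal_compact.
split; split.
- by move=> ep; apply: c_nf => //; apply: coh; exact: embedding_coherent_values.
- by move=> /(nf_c _ skk) nf M Mt Mc kM Ms; exact: normal_embedding.
- by move=> /(nf_c _ skk); exact: c_nf.
- by move=> /(nf_c _ sww); exact: c_nf.
Qed.
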